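(* Let $C=\mathtt{while}(\varphi)\{B\}\in\mathsf{pWhile}(\mathsf{Terms},\mathsf{Guards})$ be such that $B$ is loop-free. Let $\mathsf{I},\mathsf{f}\in\mathsf{Expr}$ and $\mathsf{J},\mathsf{g}\in\mathsf{Expr}^{\le1}$ all be quantifier-free syntactic expectations, and let $N\ge1$ be an integer. Then one can (1) decide whether $[\![\mathsf{I}]\!]$ is a $\overline{\mathsf{wp}}^N$-superinvariant of $C$ w.r.t. $[\![\mathsf{f}]\!]$ by an (effective) reduction to $\mathsf{QF\_NRA}$; if the superinvariant property holds, then $\mathsf{wp}[C]([\![\mathsf{f}]\!])\sqsubseteq[\![\mathsf{I}]\!]$, provided $[\![\mathsf{f}]\!]\in\mathbb{E}_{meas}$; (2) decide whether $[\![\mathsf{J}]\!]$ is a $\underline{\mathsf{wlp}}^N$-subinvariant of $C$ w.r.t. $[\![\mathsf{g}]\!]$ by an (effective) reduction to $\mathsf{QF\_NRA}$; if the subinvariant property holds, then $[\![\mathsf{J}]\!]\sqsubseteq\mathsf{wlp}[C]([\![\mathsf{g}]\!])$, provided $[\![\mathsf{g}]\!]\in\mathbb{E}^{\le1}_{meas}$.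
   Context: Programs. Let $V$ be a finite set of program variables and $S=\mathbb{R}_{\ge 0}^V$ the set of states with its Borel $\sigma$-algebra; $\sigma[x\mapsto\xi]$ is the updated state. Programs are generated by $C ::= \mathtt{skip} \mid \mathtt{diverge} \mid x:=E \mid \mathtt{observe}(\varphi) \mid x:\approx\mathtt{unif}_{[0,1]} \mid \mathtt{if}(\varphi)\{C\}\,\mathtt{else}\,\{C\} \mid \{C\}[p]\{C\} \mid C;C \mid \mathtt{while}(\varphi)\{C\}$, with $x\in V$, $p\in[0,1]\cap\mathbb{Q}$, $E:S\to\mathbb{R}_{\ge0}$ and $\varphi:S\to\{\mathrm{true},\mathrm{false}\}$ measurable; $[\varphi]$ is the indicator function of $\varphi$. Loop-free means without while-loops. $\mathsf{pWhile}(\mathsf{Terms},\mathsf{Guards})$ consists of the programs in which all $E$ and $\varphi$ are (given by) syntactic terms and guards, as defined below, over variables in $V$. Expectations. $\mathbb{E}$: all functions $S\to[0,\infty]$; $\mathbb{E}^{\le 1}$: all functions $S\to[0,1]$; $\mathbb{E}_{meas}$, $\mathbb{E}^{\le 1}_{meas}$: the Borel measurable ones. $\sqsubseteq$ is the pointwise order; $+,\cdot$ pointwise, $0\cdot\infty=0$; $f[x/E]=\big(\sigma\mapsto f(\sigma[x\mapsto E(\sigma)])\big)$. Exact transformers. $\mathsf{wp}[C]:\mathbb{E}_{meas}\to\mathbb{E}_{meas}$: $\mathsf{wp}[\mathtt{skip}](f)=f$; $\mathsf{wp}[\mathtt{diverge}](f)=0$; $\mathsf{wp}[x:=E](f)=f[x/E]$;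 $\mathsf{wp}[x:\approx\mathtt{unif}_{[0,1]}](f)(\sigma)=\int_{[0,1]}f(\sigma[x\mapsto\xi])\,d\lambda(\xi)$ (Lebesgue); $\mathsf{wp}[\mathtt{observe}(\varphi)](f)=[\varphi]\cdot f$; $\mathsf{wp}[\mathtt{if}(\varphi)\{C_1\}\mathtt{else}\{C_2\}](f)=[\varphi]\cdot\mathsf{wp}[C_1](f)+[\neg\varphi]\cdot\mathsf{wp}[C_2](f)$; $\mathsf{wp}[\{C_1\}[p]\{C_2\}](f)=p\cdot\mathsf{wp}[C_1](f)+(1-p)\cdot\mathsf{wp}[C_2](f)$; $\mathsf{wp}[C_1;C_2](f)=\mathsf{wp}[C_1](\mathsf{wp}[C_2](f))$; $\mathsf{wp}[\mathtt{while}(\varphi)\{B\}](f)$ is the least fixed point of $Y\mapsto[\neg\varphi]\cdot f+[\varphi]\cdot\mathsf{wp}[B](Y)$. $\mathsf{wlp}[C]:\mathbb{E}^{\le 1}_{meas}\to\mathbb{E}^{\le 1}_{meas}$: same rules except $\mathsf{wlp}[\mathtt{diverge}](f)=1$ and greatest instead of least fixed points for loops. Riemann transformers. For $N\ge1$, $\overline{\mathsf{wp}}^N[C]:\mathbb{E}\to\mathbb{E}$ follows the rules of $\mathsf{wp}$ (on all of $\mathbb{E}$), except $\overline{\mathsf{wp}}^N[x:\approx\mathtt{unif}_{[0,1]}](f)=\frac1N\sum_{i=0}^{N-1}\sup_{\xi\in[i/N,(i+1)/N]}f[x/\xi]$; $\underline{\mathsf{wlp}}^N[C]:\mathbb{E}^{\le1}\to\mathbb{E}^{\le1}$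 follows the rules of $\mathsf{wlp}$ (on all of $\mathbb{E}^{\le1}$), except $\underline{\mathsf{wlp}}^N[x:\approx\mathtt{unif}_{[0,1]}](f)=\frac1N\sum_{i=0}^{N-1}\inf_{\xi\in[i/N,(i+1)/N]}f[x/\xi]$. For $C=\mathtt{while}(\varphi)\{B\}$: $I\in\mathbb{E}$ is a $\overline{\mathsf{wp}}^N$-superinvariant of $C$ w.r.t. $f$ if $[\varphi]\cdot\overline{\mathsf{wp}}^N[B](I)+[\neg\varphi]\cdot f\sqsubseteq I$; $J\in\mathbb{E}^{\le1}$ is a $\underline{\mathsf{wlp}}^N$-subinvariant of $C$ w.r.t. $g\in\mathbb{E}^{\le 1}$ if $J\sqsubseteq[\varphi]\cdot\underline{\mathsf{wlp}}^N[B](J)+[\neg\varphi]\cdot g$. Syntax. Let $LV\supseteq V$ be a countably infinite set of logical variables. $\mathsf{Terms}$: $\mathsf{t}::=q\in\mathbb{Q}_{\ge0}\mid x\in LV\mid\mathsf{t}+\mathsf{t}\mid\mathsf{t}\mathbin{\dot-}\mathsf{t}\mid\mathsf{t}\cdot\mathsf{t}$, with $a\mathbin{\dot-}b=\max(a-b,0)$. $\mathsf{Guards}$: $\phi::=\mathsf{t}<\mathsf{t}\mid\neg\phi\mid\phi\land\phi$. Both are interpreted over $\mathbb{R}_{\ge0}$ in the standard way. $\mathsf{Expr}$: $\mathsf{f}::=\mathsf{t}\mid[\phi]\cdot\mathsf{f}\mid q\cdot\mathsf{f}\mid\mathsf{f}+\mathsf{f}\mid\mathrm{Sup}_{[a,b]}x:\mathsf{f}\mid\mathrm{Inf}_{[a,b]}x:\mathsf{f}$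 with $q,a,b\in\mathbb{Q}_{\ge0}$, $a\le b$; the semantics $[\![\mathsf{f}]\!]$ is the evident one, with $[\![\mathrm{Sup}_{[a,b]}x:\mathsf{f}]\!](\sigma)=\sup_{\xi\in[a,b]}[\![\mathsf{f}]\!](\sigma[x\mapsto\xi])$ and dually for $\mathrm{Inf}$. An expression is quantifier-free if it contains neither $\mathrm{Sup}$ nor $\mathrm{Inf}$. A syntactic expectation is an $\mathsf{f}\in\mathsf{Expr}$ whose free variables lie in $V$ (so $[\![\mathsf{f}]\!]\in\mathbb{E}$); $\mathsf{Expr}^{\le1}$ is the set of those with $[\![\mathsf{f}]\!]\in\mathbb{E}^{\le1}$. $\mathsf{QF\_NRA}$ is the decision problem whether a given quantifier-free first-order formula (Boolean combination of polynomial (in)equalities with rational coefficients) is satisfiable over $\mathbb{R}$. Reducing an entailment-type question to $\mathsf{QF\_NRA}$ means computing a quantifier-free formula that is valid (i.e. whose negation is unsatisfiable) iff the answer is yes. *)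

(* Defs.v *)
From HB Require Import structures.
From mathcomp Require Import all_boot all_order all_algebra finmap.
From mathcomp Require Import all_classical all_reals all_analysis.
From mathcomp Require Import measurable_realfun.
Import Order.TTheory GRing.Theory Num.Theory.
Import numFieldNormedType.Exports.

Set Implicit Arguments.
Unset Strict Implicit.
Unset Printing Implicit Defensive.

Local Open Scope classical_set_scope.
Local Open Scope ring_scope.

(* The countably infinite set of logical variables is [nat]; program variables
   range over a finite subset [V : {fset nat}] of it. *)

Inductive term : Type :=
| TConst of {nonneg rat}
| TVar of nat
| TAdd of term & term
| TMonus of term & term
| TMul of term & term.

Inductive guard : Type :=
| GLt of term & term
| GNot of guard
| GAnd of guard & guard.

Inductive expr : Type :=
| ETerm of term
| EGuard of guard & expr
| EScale of {nonneg rat} & expr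
| EAdd of expr & expr
| ESup (a b : {nonneg rat}) of a%:num <= b%:num & nat & expr
| EInf (a b : {nonneg rat}) of a%:num <= b%:num & nat & expr.

Fixpoint quantifier_free (f : expr) : bool :=
  match f with
  | ETerm _ => true
  | EGuard _ g | EScale _ g => quantifier_free g
  | EAdd g h => quantifier_free g && quantifier_free h
  | ESup _ _ _ _ _ | EInf _ _ _ _ _ => false
  end.

Fixpoint term_fv (t : term) : {fset nat} :=
  match t with
  | TConst _ => fset0
  | TVar x => [fset x]%fset
  | TAdd s u | TMonus s u | TMul s u => (term_fv s `|` term_fv u)%fset
  end.

Fixpoint guard_fv (phi : guard) : {fset nat} :=
  match phi with
  | GLt s u => (term_fv s `|` term_fv u)%fset
  | GNot psi => guard_fv psi
  | GAnd psi chi => (guard_fv psi `|` guard_fv chi)%fset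
  end.

Fixpoint expr_fv (f : expr) : {fset nat} :=
  match f with
  | ETerm t => term_fv t
  | EGuard phi g => (guard_fv phi `|` expr_fv g)%fset
  | EScale _ g => expr_fv g
  | EAdd g h => (expr_fv g `|` expr_fv h)%fset
  | ESup _ _ _ x g | EInf _ _ _ x g => (expr_fv g `\ x)%fset
  end.

Definition syntactic_expectation (V : {fset nat}) (f : expr) : bool :=
  (expr_fv f `<=` V)%fset.

(* Programs over variables [X], right-hand sides [E] and conditions [G]. With
   [E := term] and [G := guard] these are finite syntactic objects; with
   functions on states they are the programs the transformers act on. *)
Inductive cmd (X E G : Type) : Type :=
| Skip
| Diverge
| Assign of X & E
| Observe of G
| Unif of X
| If of G & cmd X E G & cmd X E G
| PChoice of {i01 rat} & cmd X E G & cmd X E G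
| Seq of cmd X E G & cmd X E G
| While of G & cmd X E G.
Arguments Skip {X E G}.
Arguments Diverge {X E G}.
Arguments Assign {X E G}.
Arguments Observe {X E G}.
Arguments Unif {X E G}.
Arguments If {X E G}.
Arguments PChoice {X E G}.
Arguments Seq {X E G}.
Arguments While {X E G}.

Fixpoint loop_free X E G (C : cmd X E G) : bool :=
  match C with
  | If _ C1 C2 | PChoice _ C1 C2 | Seq C1 C2 => loop_free C1 && loop_free C2
  | While _ _ => false
  | _ => true
  end.

Fixpoint pwhile (V : {fset nat}) (C : cmd V term guard) : bool :=
  match C with
  | Skip | Diverge | Unif _ => true
  | Assign _ t => (term_fv t `<=` V)%fset
  | Observe phi => (guard_fv phi `<=` V)%fset
  | If phi C1 C2 => [&& (guard_fv phi `<=` V)%fset, pwhile C1 & pwhile C2]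
  | PChoice _ C1 C2 | Seq C1 C2 => pwhile C1 && pwhile C2
  | While phi B => (guard_fv phi `<=` V)%fset && pwhile B
  end.

Section Semantics.
Variable R : realType.

Definition nnratr (q : {nonneg rat}) : {nonneg R} :=
  NngNum (etrans (ler0q R q%:num) [ge0 of q%:num]).

Definition upd (X : eqType) (s : X -> {nonneg R}) (x : X) (xi : {nonneg R}) :
    X -> {nonneg R} :=
  fun y => if y == x then xi else s y.

Definition rseg (a b : R) : set {nonneg R} := [set xi | a <= xi%:num <= b].

Definition iverson (b : bool) : \bar R := (b%:R)%:E.

Fixpoint term_sem (t : term) (s : nat -> {nonneg R}) : {nonneg R} :=
  match t with
  | TConst q => nnratr q
  | TVar x => s x
  | TAdd u v => ((term_sem u s)%:num + (term_sem v s)%:num)%:nng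
  | TMonus u v => (Num.max ((term_sem u s)%:num - (term_sem v s)%:num) 0)%:nng
  | TMul u v => ((term_sem u s)%:num * (term_sem v s)%:num)%:nng
  end.

Fixpoint guard_sem (phi : guard) (s : nat -> {nonneg R}) : bool :=
  match phi with
  | GLt u v => (term_sem u s)%:num < (term_sem v s)%:num
  | GNot psi => ~~ guard_sem psi s
  | GAnd psi chi => guard_sem psi s && guard_sem chi s
  end.

Fixpoint expr_sem (f : expr) (s : nat -> {nonneg R}) : \bar R :=
  match f with
  | ETerm t => ((term_sem t s)%:num)%:E
  | EGuard phi g => (iverson (guard_sem phi s) * expr_sem g s)%E
  | EScale q g => (((nnratr q)%:num)%:E * expr_sem g s)%E
  | EAdd g h => (expr_sem g s + expr_sem h s)%E
  | ESup a b _ x g => ereal_sup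
      [set expr_sem g (upd s x xi) | xi in rseg (ratr a%:num) (ratr b%:num)]
  | EInf a b _ x g => ereal_inf
      [set expr_sem g (upd s x xi) | xi in rseg (ratr a%:num) (ratr b%:num)]
  end.

Variable V : {fset nat}.

Definition state : Type := V -> {nonneg R}.

(* Values outside [V] are irrelevant for objects with free variables in [V]. *)
Definition ext (s : state) : nat -> {nonneg R} :=
  fun n => if insub n is Some x then s x else 0%:nng.

Definition exptn : Type := state -> \bar R.

Definition expr_den (f : expr) : exptn := fun s => expr_sem f (ext s).

Definition prog : Type := cmd V (state -> {nonneg R}) (state -> bool).

Fixpoint prog_den (C : cmd V term guard) : prog :=
  match C with
  | Skip => Skip
  | Diverge => Diverge
  | Assign x t => Assign x (fun s : state => term_sem t (ext s))
  | Observe phi => Observe (fun s : state => guard_sem phi (ext s))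
  | Unif x => Unif x
  | If phi C1 C2 =>
      If (fun s : state => guard_sem phi (ext s)) (prog_den C1) (prog_den C2)
  | PChoice p C1 C2 => PChoice p (prog_den C1) (prog_den C2)
  | Seq C1 C2 => Seq (prog_den C1) (prog_den C2)
  | While phi B => While (fun s : state => guard_sem phi (ext s)) (prog_den B)
  end.

HB.instance Definition _ := gen_eqMixin state.
HB.instance Definition _ := gen_choiceMixin state.
HB.instance Definition _ := isPointed.Build state (fun=> 0%:nng).

(* The topology of the nonnegative orthant as a subspace of the product
   [V -> R]. *)
Definition state_open : set (set state) :=
  open : set (set (initial_topology
    (fun s : state => (fun x => (s x)%:num) : {ptws V -> R}))).

Definition Exp : set exptn := [set f | forall s, (0 <= f s)%E].
Definition Exp1 : set exptn := [set f | forall s, (0 <= f s <= 1)%E].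
Definition Borel_fun : set exptn :=
  [set f : exptn | measurable_fun [set: g_sigma_algebraType state_open] f].
Definition ExpM : set exptn := Exp `&` Borel_fun.
Definition Exp1M : set exptn := Exp1 `&` Borel_fun.

Definition ele (f g : exptn) : Prop := forall s, (f s <= g s)%E.

(* The default values for the case that there is no least (greatest) fixed
   point are chosen so that they cannot make an upper (lower) bound true. *)
Definition lfp (D : set exptn) (Phi : exptn -> exptn) :
    exptn :=
  xget (fun=> +oo%E) [set Y | [/\ D Y, Phi Y = Y &
    forall Z, D Z -> Phi Z = Z -> ele Y Z]].
Definition gfp (D : set exptn) (Phi : exptn -> exptn) :
    exptn :=
  xget (fun=> 0%E) [set Y | [/\ D Y, Phi Y = Y &
    forall Z, D Z -> Phi Z = Z -> ele Z Y]].

(* The rules shared by the four transformers, which differ in the value [d] of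
   [Diverge], the fixed points [fixpt] of loops and the rule [unif] for
   sampling. *)
Fixpoint transformer (d : \bar R)
    (fixpt : (exptn -> exptn) -> exptn)
    (unif : V -> exptn -> exptn)
    (C : prog) (f : exptn) : exptn :=
  let T := transformer d fixpt unif in
  match C with
  | Skip => f
  | Diverge => fun=> d
  | Assign x E => fun s => f (upd s x (E s))
  | Observe phi => fun s => (iverson (phi s) * f s)%E
  | Unif x => unif x f
  | If phi C1 C2 => fun s =>
      (iverson (phi s) * T C1 f s + iverson (~~ phi s) * T C2 f s)%E
  | PChoice p C1 C2 => fun s =>
      ((ratr p%:num)%:E * T C1 f s + (1 - ratr p%:num)%:E * T C2 f s)%E
  | Seq C1 C2 => T C1 (T C2 f)
  | While phi B => fixpt (fun Y s =>
      (iverson (~~ phi s) * f s + iverson (phi s) * T B Y s)%E)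
  end.

(* [`|xi|] equals [xi] on [0, 1] and only serves to obtain a nonnegative. *)
Definition lebesgue_unif (x : V) (f : exptn) : exptn := fun s =>
  (\int[@lebesgue_measure R]_(xi in `[0%R, 1%R])
     f (upd s x (`|xi : R|%:nng)%R))%E.

Definition upper_unif (N : nat) (x : V) (f : exptn) : exptn :=
  fun s => ((N%:R^-1)%:E * \sum_(i < N) ereal_sup
    [set f (upd s x xi) | xi in rseg (i%:R / N%:R) (i.+1%:R / N%:R)])%E.

Definition lower_unif (N : nat) (x : V) (f : exptn) : exptn :=
  fun s => ((N%:R^-1)%:E * \sum_(i < N) ereal_inf
    [set f (upd s x xi) | xi in rseg (i%:R / N%:R) (i.+1%:R / N%:R)])%E.

Definition wp : prog -> exptn -> exptn :=
  transformer 0%E (lfp ExpM) lebesgue_unif.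
Definition wlp : prog -> exptn -> exptn :=
  transformer 1%E (gfp Exp1M) lebesgue_unif.
Definition upper_wp (N : nat) : prog -> exptn -> exptn :=
  transformer 0%E (lfp Exp) (upper_unif N).
Definition lower_wlp (N : nat) : prog -> exptn -> exptn :=
  transformer 1%E (gfp Exp1) (lower_unif N).

Definition superinvariant (N : nat) (C : prog) (f I : exptn) : Prop :=
  if C is While phi B then
    Exp I /\ ele (fun s => iverson (phi s) * upper_wp N B I s
                           + iverson (~~ phi s) * f s)%E I
  else False.

Definition subinvariant (N : nat) (C : prog) (g J : exptn) : Prop :=
  if C is While phi B then
    Exp1 J /\ ele J (fun s => iverson (phi s) * lower_wlp N B J s
                              + iverson (~~ phi s) * g s)%E
  else False.

End Semantics.

Inductive poly_term : Type :=
| PConst of rat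
| PVar of nat
| PAdd of poly_term & poly_term
| PSub of poly_term & poly_term
| PMul of poly_term & poly_term.

Inductive qf_formula : Type :=
| FEq of poly_term & poly_term
| FLe of poly_term & poly_term
| FLt of poly_term & poly_term
| FNot of qf_formula
| FAnd of qf_formula & qf_formula
| FOr of qf_formula & qf_formula.

Section QF_NRA.
Variable R : realType.

Fixpoint poly_sem (p : poly_term) (v : nat -> R) : R :=
  match p with
  | PConst q => ratr q
  | PVar x => v x
  | PAdd p1 p2 => poly_sem p1 v + poly_sem p2 v
  | PSub p1 p2 => poly_sem p1 v - poly_sem p2 v
  | PMul p1 p2 => poly_sem p1 v * poly_sem p2 v
  end.

Fixpoint qf_holds (F : qf_formula) (v : nat -> R) : Prop :=
  match F with
  | FEq p1 p2 => poly_sem p1 v = poly_sem p2 v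
  | FLe p1 p2 => poly_sem p1 v <= poly_sem p2 v
  | FLt p1 p2 => poly_sem p1 v < poly_sem p2 v
  | FNot G => ~ qf_holds G v
  | FAnd G H => qf_holds G v /\ qf_holds H v
  | FOr G H => qf_holds G v \/ qf_holds H v
  end.

Definition qf_nra (F : qf_formula) : Prop :=
  exists v : nat -> R, qf_holds F v.

Definition qf_valid (F : qf_formula) : Prop := ~ qf_nra (FNot F).

End QF_NRA.

(* The model of computation is Jones' Turing-complete first-order functional
   language F over binary trees ("Computability and Complexity from a
   Programming Perspective", 1997), with several mutually recursive unary
   functions. That a mere Rocq function with some input-output behaviour exists
   would already follow from the axiom of choice. *)

Inductive tree : Type := Leaf | Node of tree & tree.

Inductive fl_expr : Type :=
| KArg
| KLeaf
| KNode of fl_expr & fl_expr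
| KLeft of fl_expr
| KRight of fl_expr
| KIf of fl_expr & fl_expr & fl_expr
| KCall of nat & fl_expr.

Definition left_tree (t : tree) : tree := if t is Node l _ then l else Leaf.
Definition right_tree (t : tree) : tree := if t is Node _ r then r else Leaf.

(* [eval P a e r]: with the function bodies [P] and the argument [a] of the
   current function, [e] evaluates to [r]. *)
Inductive eval (P : seq fl_expr) (a : tree) : fl_expr -> tree -> Prop :=
| eval_arg : eval P a KArg a
| eval_leaf : eval P a KLeaf Leaf
| eval_node e1 e2 r1 r2 : eval P a e1 r1 -> eval P a e2 r2 ->
    eval P a (KNode e1 e2) (Node r1 r2)
| eval_left e r : eval P a e r -> eval P a (KLeft e) (left_tree r)
| eval_right e r : eval P a e r -> eval P a (KRight e) (right_tree r)
| eval_if_node e e1 e2 l r r1 : eval P a e (Node l r) -> eval P a e1 r1 ->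
    eval P a (KIf e e1 e2) r1
| eval_if_leaf e e1 e2 r2 : eval P a e Leaf -> eval P a e2 r2 ->
    eval P a (KIf e e1 e2) r2
| eval_call k e b r : eval P a e b -> eval P b (nth KLeaf P k) r ->
    eval P a (KCall k e) r.

Definition computes (P : seq fl_expr) (a r : tree) : Prop :=
  eval P a (KCall 0 KArg) r.

Fixpoint enc_nat (n : nat) : tree :=
  if n is m.+1 then Node Leaf (enc_nat m) else Leaf.

Definition enc_int (z : int) : tree :=
  match z with
  | Posz n => Node Leaf (enc_nat n)
  | Negz n => Node (Node Leaf Leaf) (enc_nat n)
  end.

Definition enc_rat (q : rat) : tree :=
  Node (enc_int (numq q)) (enc_int (denq q)).

Definition tag (k : nat) (t : tree) : tree := Node (enc_nat k) t.

Fixpoint enc_term (t : term) : tree :=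
  match t with
  | TConst q => tag 0 (enc_rat q%:num)
  | TVar x => tag 1 (enc_nat x)
  | TAdd s u => tag 2 (Node (enc_term s) (enc_term u))
  | TMonus s u => tag 3 (Node (enc_term s) (enc_term u))
  | TMul s u => tag 4 (Node (enc_term s) (enc_term u))
  end.

Fixpoint enc_guard (phi : guard) : tree :=
  match phi with
  | GLt s u => tag 0 (Node (enc_term s) (enc_term u))
  | GNot psi => tag 1 (enc_guard psi)
  | GAnd psi chi => tag 2 (Node (enc_guard psi) (enc_guard chi))
  end.

Fixpoint enc_expr (f : expr) : tree :=
  match f with
  | ETerm t => tag 0 (enc_term t)
  | EGuard phi g => tag 1 (Node (enc_guard phi) (enc_expr g))
  | EScale q g => tag 2 (Node (enc_rat q%:num) (enc_expr g))
  | EAdd g h => tag 3 (Node (enc_expr g) (enc_expr h))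
  | ESup a b _ x g => tag 4 (Node (Node (enc_rat a%:num) (enc_rat b%:num))
                                  (Node (enc_nat x) (enc_expr g)))
  | EInf a b _ x g => tag 5 (Node (Node (enc_rat a%:num) (enc_rat b%:num))
                                  (Node (enc_nat x) (enc_expr g)))
  end.

Fixpoint enc_cmd (V : {fset nat}) (C : cmd V term guard) : tree :=
  match C with
  | Skip => tag 0 Leaf
  | Diverge => tag 1 Leaf
  | Assign x t => tag 2 (Node (enc_nat (val x)) (enc_term t))
  | Observe phi => tag 3 (enc_guard phi)
  | Unif x => tag 4 (enc_nat (val x))
  | If phi C1 C2 => tag 5 (Node (enc_guard phi) (Node (enc_cmd C1) (enc_cmd C2)))
  | PChoice p C1 C2 =>
      tag 6 (Node (enc_rat p%:num) (Node (enc_cmd C1) (enc_cmd C2)))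
  | Seq C1 C2 => tag 7 (Node (enc_cmd C1) (enc_cmd C2))
  | While phi B => tag 8 (Node (enc_guard phi) (enc_cmd B))
  end.

Fixpoint enc_poly (p : poly_term) : tree :=
  match p with
  | PConst q => tag 0 (enc_rat q)
  | PVar x => tag 1 (enc_nat x)
  | PAdd p1 p2 => tag 2 (Node (enc_poly p1) (enc_poly p2))
  | PSub p1 p2 => tag 3 (Node (enc_poly p1) (enc_poly p2))
  | PMul p1 p2 => tag 4 (Node (enc_poly p1) (enc_poly p2))
  end.

Fixpoint enc_formula (F : qf_formula) : tree :=
  match F with
  | FEq p1 p2 => tag 0 (Node (enc_poly p1) (enc_poly p2))
  | FLe p1 p2 => tag 1 (Node (enc_poly p1) (enc_poly p2))
  | FLt p1 p2 => tag 2 (Node (enc_poly p1) (enc_poly p2))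
  | FNot G => tag 3 (enc_formula G)
  | FAnd G H => tag 4 (Node (enc_formula G) (enc_formula H))
  | FOr G H => tag 5 (Node (enc_formula G) (enc_formula H))
  end.

Definition enc_input (V : {fset nat}) (C : cmd V term guard) (f1 f2 : expr)
    (N : nat) : tree :=
  Node (enc_cmd C) (Node (Node (enc_expr f1) (enc_expr f2)) (enc_nat N)).

(* Main.v *)
(* The supremum over a Riemann piece sits on the smaller side of the inequality
   that defines superinvariants (dually, the infimum on the larger side), so it
   may be replaced by a universal quantifier. Executing the loop body forward
   and symbolically, with a fresh real variable for every sampled value, turns
   the inequality into the validity of a quantifier-free formula: the values of
   terms, guards and expectations are decision trees with polynomials at the
   leaves. Sums of suprema are suprema of sums because the summands draw their
   choices from disjoint parts of the stream of fresh variables.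

   For soundness, the exact transformer of a loop-free body preserves
   measurability and is continuous along Kleene chains, by monotone (for wp) or
   dominated (for wlp) convergence, so the loop semantics is the limit of its
   Kleene iterates; each iterate is bounded by the invariant because integrals
   are bounded by Riemann sums. *)
Require Import Defs.
From mathcomp Require Import all_boot all_order all_algebra finmap.
From mathcomp Require Import all_classical all_reals all_analysis.
From mathcomp Require Import measurable_realfun lra zify.
Import Order.TTheory GRing.Theory Num.Theory.
Import numFieldNormedType.Exports.

Set Implicit Arguments.
Unset Strict Implicit.
Unset Printing Implicit Defensive.

Local Open Scope classical_set_scope.
Local Open Scope ring_scope.

Local Notation eval := Defs.eval.

(** * The reduction as a function on syntax *)

(** Upper and lower case are one development with a boolean [upper]; the lower one reverses the
    order. Between the formula and the Riemann transformer stands [resolve], a real-valued function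
    of a state and a stream of choices: the formula states an inequality about it, and the
    transformer is its optimum over all streams. Choices are not constrained by hypotheses. One that
    misses its piece yields 0 (upper) or 1 (lower), which never improves the optimum because all
    values are nonnegative (at most 1). So every summand is a total function of its own stream,
    which lets optima pass through sums. The reduction exists twice, as a Rocq function in
    continuation-passing style and as an F program. F has no higher-order values, so there the
    continuation is a stack of pending commands. It has no built-in arithmetic either, which is why
    all rational constants of the formula can be copied from the input or built from unary numbers
    without normalizing fractions. *)

Inductive dtree : Type :=
| Ret of poly_term
| Ite of qf_formula & dtree & dtree.

Inductive binop : Type := OAdd | OMonus | OMul | OLt.

Local Notation pzero := (PConst 0%Q).
Local Notation pone := (PConst 1%Q).

Definition ret_op (o : binop) (p q : poly_term) : dtree :=
  match o with
  | OAdd => Ret (PAdd p q)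
  | OMonus => Ite (FLe q p) (Ret (PSub p q)) (Ret pzero)
  | OMul => Ret (PMul p q)
  | OLt => Ite (FLt p q) (Ret pone) (Ret pzero)
  end.

Fixpoint app_ret (o : binop) (p : poly_term) (u : dtree) : dtree :=
  match u with
  | Ret q => ret_op o p q
  | Ite c l r => Ite c (app_ret o p l) (app_ret o p r)
  end.

Fixpoint app (o : binop) (t u : dtree) : dtree :=
  match t with
  | Ret p => app_ret o p u
  | Ite c l r => Ite c (app o l u) (app o r u)
  end.

Definition compl (t : dtree) : dtree := app OMonus (Ret pone) t.

Fixpoint zero_formula (t : dtree) : qf_formula :=
  match t with
  | Ret p => FEq p pzero
  | Ite c l r => FOr (FAnd c (zero_formula l)) (FAnd (FNot c) (zero_formula r))
  end.

(* Variables that have not been assigned are read as squares, which range over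
   exactly the nonnegative reals, so that no sign hypotheses are needed. *)
Fixpoint lookup (env : seq (nat * dtree)) (x : nat) : dtree :=
  match env with
  | [::] => Ret (PMul (PVar (x + x)) (PVar (x + x)))
  | (y, t) :: env' => if x == y then t else lookup env' x
  end.

Fixpoint comp_term (t : term) (env : seq (nat * dtree)) : dtree :=
  match t with
  | TConst q => Ret (PConst q%:num)
  | TVar x => lookup env x
  | TAdd s u => app OAdd (comp_term s env) (comp_term u env)
  | TMonus s u => app OMonus (comp_term s env) (comp_term u env)
  | TMul s u => app OMul (comp_term s env) (comp_term u env)
  end.

(* Guards are compiled to trees with value 0 or 1. *)
Fixpoint comp_guard (phi : guard) (env : seq (nat * dtree)) : dtree :=
  match phi with
  | GLt s u => app OLt (comp_term s env) (comp_term u env)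
  | GNot psi => compl (comp_guard psi env)
  | GAnd psi chi => app OMul (comp_guard psi env) (comp_guard chi env)
  end.

Fixpoint comp_expr (f : expr) (env : seq (nat * dtree)) : dtree :=
  match f with
  | ETerm t => comp_term t env
  | EGuard phi g => app OMul (comp_guard phi env) (comp_expr g env)
  | EScale q g => app OMul (Ret (PConst q%:num)) (comp_expr g env)
  | EAdd g h => app OAdd (comp_expr g env) (comp_expr h env)
  | ESup _ _ _ _ _ | EInf _ _ _ _ _ => Ret pzero
  end.

(** A compiled guard is a tree with value 0 or 1, not a formula, so it cannot head an [Ite]; the
    conditional becomes a weighted sum. *)
Definition comp_if (phi t u : dtree) : dtree :=
  app OAdd (app OMul phi t) (app OMul (compl phi) u).

(* A continuation maps an environment and a stream of choices to a value. The
   arguments [a b] stand for the stream of the variables [a * k + b]; its two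
   halves are given by [a + a, b] and [a + a, a + b]. *)
Definition cont : Type := seq (nat * dtree) -> nat -> nat -> dtree.

Section Compile.
(* [upper] selects between the upper and the lower transformer. *)
Variables (upper : bool) (N : nat).

Definition dconst : dtree := Ret (PConst (if upper then 0%Q else 1%Q)).

(** The bounds are multiplied out by [N]: integer constants have codes that are immediate from unary
    numbers, whereas [i / N] would have to be put in lowest terms. *)
Definition in_piece (i b : nat) : qf_formula :=
  let z := PMul (PConst N%:Q) (PVar b) in
  FAnd (FLe (PConst i%:Q) z) (FLe z (PConst i.+1%:Q)).

(* A choice outside the [i]-th piece yields the neutral value [dconst]. *)
Fixpoint comp_unif (x : nat) (K : cont) (env : seq (nat * dtree))
    (i a b : nat) : dtree :=
  match i with
  | 0 => Ret pzero
  | j.+1 =>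
      app OAdd
        (Ite (in_piece j b)
           (K ((x, Ret (PVar b)) :: env) (a + a)%N (a + a + b)%N) dconst)
        (comp_unif x K env j (a + a)%N (a + b)%N)
  end.

Fixpoint comp_cmd (V : {fset nat}) (C : cmd V term guard) (K : cont) : cont :=
  fun env a b =>
  match C with
  | Skip => K env a b
  | Diverge => dconst
  | Assign x t => K ((val x, comp_term t env) :: env) a b
  | Observe phi => app OMul (comp_guard phi env) (K env a b)
  | Unif x =>
      app OMul (Ret (PConst (N%:Q^-1))) (comp_unif (val x) K env N a b)
  | If phi C1 C2 =>
      comp_if (comp_guard phi env) (comp_cmd C1 K env a b)
        (comp_cmd C2 K env a b)
  | PChoice p C1 C2 =>
      app OAdd
        (app OMul (Ret (PConst p%:num)) (comp_cmd C1 K env (a + a)%N b))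
        (app OMul (Ret (PSub pone (PConst p%:num)))
           (comp_cmd C2 K env (a + a)%N (a + b)%N))
  | Seq C1 C2 => comp_cmd C1 (comp_cmd C2 K) env a b
  | While _ _ => Ret pzero
  end.

(* State variables occupy the even indices, choices the odd ones. *)
Definition comp_step (V : {fset nat}) (phi : guard) (B : cmd V term guard)
    (I f : expr) : dtree :=
  comp_if (comp_guard phi [::])
    (comp_cmd B (fun env _ _ => comp_expr I env) [::] 2 1)
    (comp_expr f [::]).

(** The tree of a strict comparison has value 0 exactly if the reverse non-strict inequality holds,
    so [zero_formula] expresses the invariant inequality. *)
Definition reduction (V : {fset nat}) (phi : guard) (B : cmd V term guard)
    (I f : expr) : qf_formula :=
  let t := comp_step phi B I f in
  let u := comp_expr I [::] in
  zero_formula (if upper then app OLt u t else app OLt t u).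

End Compile.

(** * The reduction as a program of the language F *)

Fixpoint kquote (t : tree) : fl_expr :=
  if t is Node l r then KNode (kquote l) (kquote r) else KLeaf.

Definition ktag (k : nat) (e : fl_expr) : fl_expr :=
  KNode (kquote (enc_nat k)) e.

(** A jump table over a unary tag; each [KRight] removes one successor. *)
Fixpoint kswitch (e : fl_expr) (bs : seq fl_expr) : fl_expr :=
  if bs is b :: bs' then KIf e (kswitch (KRight e) bs') b else KLeaf.

Arguments kswitch : simpl never.

(** Conditionals are excluded too. What remains are projections and constructors, whose values [sel]
    computes, so that evaluating the arguments of calls and switches is settled by computation. *)
Fixpoint call_free (e : fl_expr) : bool :=
  match e with
  | KArg | KLeaf => true
  | KNode e1 e2 => call_free e1 && call_free e2
  | KLeft e | KRight e => call_free e
  | KIf _ _ _ | KCall _ _ => false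
  end.

Fixpoint sel (e : fl_expr) (a : tree) : tree :=
  match e with
  | KArg => a
  | KNode e1 e2 => Node (sel e1 a) (sel e2 a)
  | KLeft e => left_tree (sel e a)
  | KRight e => right_tree (sel e a)
  | KLeaf | KIf _ _ _ | KCall _ _ => Leaf
  end.

Lemma eval_sel P a e : call_free e -> eval P a e (sel e a).
Proof.
elim: e => //=; try by [constructor].
- by move=> e1 IH1 e2 IH2 /andP[/IH1 ? /IH2 ?]; constructor.
- by move=> e IH /IH ?; constructor.
- by move=> e IH /IH ?; constructor.
Qed.

Lemma sel_kquote t a : sel (kquote t) a = t.
Proof. by elim: t => //= l -> r ->. Qed.

Lemma eval_kquote P a t : eval P a (kquote t) t.
Proof. by elim: t => [|l IHl r IHr] /=; constructor. Qed.

Lemma eval_switch P a e bs k r : call_free e -> sel e a = enc_nat k ->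
  eval P a (nth KLeaf bs k) r -> (k < size bs)%N -> eval P a (kswitch e bs) r.
Proof.
elim: bs e k => [//|b bs IH] e [|k] ce se; rewrite /kswitch /= => ev lt;
  have := eval_sel P a ce; rewrite se => evs.
  exact: eval_if_leaf.
by apply: eval_if_node evs _; apply: IH ev lt => //=; rewrite se.
Qed.

Lemma eval_ifs P a e e1 e2 c r : call_free e -> sel e a = c ->
  eval P a (if c is Node _ _ then e1 else e2) r -> eval P a (KIf e e1 e2) r.
Proof.
move=> ce <-; have := eval_sel P a ce.
case: (sel e a) => [|l t] ev h; first exact: eval_if_leaf ev h.
exact: eval_if_node ev h.
Qed.

Fixpoint enc_dtree (t : dtree) : tree :=
  match t with
  | Ret p => Node Leaf (enc_poly p)
  | Ite c l r => Node (Node (enc_formula c) (enc_dtree l)) (enc_dtree r)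
  end.

(* The codes of [OAdd], [OMonus] and [OMul] agree with the tags of the
   corresponding terms and polynomials. *)
Definition enc_op (o : binop) : tree :=
  enc_nat (match o with OAdd => 2 | OMonus => 3 | OMul => 4 | OLt => 5 end).

Fixpoint enc_env (env : seq (nat * dtree)) : tree :=
  if env is (x, t) :: env' then
    Node (Node (enc_nat x) (enc_dtree t)) (enc_env env')
  else Leaf.

Fixpoint enc_stack (V : {fset nat}) (s : seq (cmd V term guard)) : tree :=
  if s is C :: s' then Node (enc_cmd C) (enc_stack s') else Leaf.

Local Notation kl := KLeft.
Local Notation kr := KRight.
Local Notation ka := KArg.

Definition kret_const (q : rat) : fl_expr :=
    kquote (enc_dtree (Ret (PConst q))).

Local Notation f_eqn := 1%N.
Local Notation f_add := 2%N.
Local Notation f_lookup := 3%N.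
Local Notation f_app_ret := 4%N.
Local Notation f_app := 5%N.
Local Notation f_term := 6%N.
Local Notation f_guard := 7%N.
Local Notation f_expr := 8%N.
Local Notation f_cmd := 9%N.
Local Notation f_unif := 10%N.
Local Notation f_zero := 11%N.

Definition kapp (o : binop) (e1 e2 : fl_expr) : fl_expr :=
  KCall f_app (KNode (kquote (enc_op o)) (KNode e1 e2)).
Definition kcompl (e : fl_expr) : fl_expr := kapp OMonus (kret_const 1) e.
Definition kif (g e1 e2 : fl_expr) : fl_expr :=
  kapp OAdd (kapp OMul g e1) (kapp OMul (kcompl g) e2).
Definition kadd (e1 e2 : fl_expr) : fl_expr := KCall f_add (KNode e1 e2).

Definition body_eqn : fl_expr :=
  KIf (kl ka)
    (KIf (kr ka) (KCall f_eqn (KNode (kr (kl ka)) (kr (kr ka)))) KLeaf)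
    (KIf (kr ka) KLeaf (kquote (Node Leaf Leaf))).

Definition body_add : fl_expr :=
  KIf (kl ka) (KNode KLeaf (kadd (kr (kl ka)) (kr ka))) (kr ka).

Definition body_lookup : fl_expr :=
  let x := kl ka in
  let sq := ktag 1 (kadd x x) in
  KIf (kr ka)
    (KIf (KCall f_eqn (KNode x (kl (kl (kr ka)))))
       (kr (kl (kr ka))) (KCall f_lookup (KNode x (kr (kr ka)))))
    (KNode KLeaf (ktag 4 (KNode sq sq))).

Definition body_app_ret : fl_expr :=
  let o := kl ka in let p := kl (kr ka) in
  let u := kr (kr ka) in let q := kr u in
  let rec e := KCall f_app_ret (KNode o (KNode p e)) in
  let zero := kret_const 0 in
  KIf (kl u) (KNode (KNode (kl (kl u)) (rec (kr (kl u)))) (rec (kr u)))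
    (kswitch o [:: KLeaf; KLeaf;
       KNode KLeaf (KNode o (KNode p q));
       KNode (KNode (ktag 1 (KNode q p)) (KNode KLeaf (KNode o (KNode p q))))
           zero;
       KNode KLeaf (KNode o (KNode p q));
       KNode (KNode (ktag 2 (KNode p q)) (kret_const 1)) zero]).

Definition body_app : fl_expr :=
  let o := kl ka in let t := kl (kr ka) in let u := kr (kr ka) in
  let rec e := KCall f_app (KNode o (KNode e u)) in
  KIf (kl t) (KNode (KNode (kl (kl t)) (rec (kr (kl t)))) (rec (kr t)))
    (KCall f_app_ret (KNode o (KNode (kr t) u))).

Definition body_term : fl_expr :=
  let t := kr (kl ka) in let env := kr ka in
  let rec e := KCall f_term (KNode e env) in
  let bin o := kapp o (rec (kl t)) (rec (kr t)) in
  kswitch (kl (kl ka)) [:: KNode KLeaf (ktag 0 t); KCall f_lookup (KNode t env);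
    bin OAdd; bin OMonus; bin OMul].

Definition body_guard : fl_expr :=
  let g := kr (kl ka) in let env := kr ka in
  let rec e := KCall f_guard (KNode e env) in
  let tm e := KCall f_term (KNode e env) in
  kswitch (kl (kl ka)) [:: kapp OLt (tm (kl g)) (tm (kr g)); kcompl (rec g);
    kapp OMul (rec (kl g)) (rec (kr g))].

Definition body_expr : fl_expr :=
  let f := kr (kl ka) in let env := kr ka in
  let rec e := KCall f_expr (KNode e env) in
  kswitch (kl (kl ka)) [:: KCall f_term (KNode f env);
    kapp OMul (KCall f_guard (KNode (kl f) env)) (rec (kr f));
    kapp OMul (KNode KLeaf (ktag 0 (kl f))) (rec (kr f));
    kapp OAdd (rec (kl f)) (rec (kr f))].

(* The argument consists of the stack of commands, the pair of the final
   expression and [N], the environment, and the two stream parameters. *)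
Definition karg_cmd (s ctx env a b : fl_expr) : fl_expr :=
  KNode s (KNode ctx (KNode env (KNode a b))).

Definition body_cmd (upper : bool) : fl_expr :=
  let s := kl ka in let ctx := kl (kr ka) in let env := kl (kr (kr ka)) in
  let a := kl (kr (kr (kr ka))) in let b := kr (kr (kr (kr ka))) in
  let c := kr (kl s) in let s' := kr s in
  let run s env a b := KCall f_cmd (karg_cmd s ctx env a b) in
  let gd g := KCall f_guard (KNode g env) in
  KIf s
    (kswitch (kl (kl s)) [::
       run s' env a b;
       kret_const (if upper then 0%Q else 1%Q);
       run s' (KNode (KNode (kl c) (KCall f_term (KNode (kr c) env))) env) a b;
       kapp OMul (gd c) (run s' env a b);
       kapp OMul
         (KNode KLeaf (ktag 0 (KNode (kquote (enc_int 1))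
             (KNode KLeaf (kr ctx)))))
         (KCall f_unif
            (KNode (kr ctx) (KNode c (karg_cmd s' ctx env a b))));
       kif (gd (kl c)) (run (KNode (kl (kr c)) s') env a b)
         (run (KNode (kr (kr c)) s') env a b);
       kapp OAdd
         (kapp OMul (KNode KLeaf (ktag 0 (kl c)))
            (run (KNode (kl (kr c)) s') env (kadd a a) b))
         (kapp OMul
            (KNode KLeaf
               (ktag 3 (KNode (kquote (enc_poly pone)) (ktag 0 (kl c)))))
            (run (KNode (kr (kr c)) s') env (kadd a a) (kadd a b)));
       run (KNode (kl c) (KNode (kr c) s')) env a b])
    (KCall f_expr (KNode (kl ctx) env)).

Definition knatq (e : fl_expr) : fl_expr :=
  ktag 0 (KNode (KNode KLeaf e) (kquote (enc_int 1))).

Definition body_unif (upper : bool) : fl_expr :=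
  let i := kl ka in let x := kl (kr ka) in let st := kr (kr ka) in
  let s := kl st in let ctx := kl (kr st) in let env := kl (kr (kr st)) in
  let a := kl (kr (kr (kr st))) in let b := kr (kr (kr (kr st))) in
  let zb := ktag 1 b in
  let z := ktag 4 (KNode (knatq (kr ctx)) zb) in
  KIf i
    (kapp OAdd
       (KNode (KNode (ktag 4 (KNode (ktag 1 (KNode (knatq (kr i)) z))
                                    (ktag 1 (KNode z (knatq i)))))
                 (KCall f_cmd (karg_cmd s ctx
                    (KNode (KNode x (KNode KLeaf zb)) env)
                    (kadd a a) (kadd (kadd a a) b))))
          (kret_const (if upper then 0%Q else 1%Q)))
       (KCall f_unif (KNode (kr i)
          (KNode x (karg_cmd s ctx env (kadd a a) (kadd a b))))))
    (kret_const 0).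

Definition body_zero : fl_expr :=
  let c := kl (kl ka) in
  KIf (kl ka)
    (ktag 5 (KNode (ktag 4 (KNode c (KCall f_zero (kr (kl ka)))))
                   (ktag 4 (KNode (ktag 3 c) (KCall f_zero (kr ka))))))
    (ktag 0 (KNode (kr ka) (kquote (enc_poly pzero)))).

Definition body_main (upper : bool) : fl_expr :=
  let c := kr (kl ka) in let I := kl (kl (kr ka)) in let f := kr (kl (kr ka)) in
  let N := kr (kr ka) in
  let t := kif (KCall f_guard (KNode (kl c) KLeaf))
      (KCall f_cmd (karg_cmd (KNode (kr c) KLeaf) (KNode I N) KLeaf
         (kquote (enc_nat 2)) (kquote (enc_nat 1))))
      (KCall f_expr (KNode f KLeaf)) in
  let u := KCall f_expr (KNode I KLeaf) in
  KCall f_zero (if upper then kapp OLt u t else kapp OLt t u).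

Definition program (upper : bool) : seq fl_expr :=
  [:: body_main upper; body_eqn; body_add; body_lookup; body_app_ret; body_app;
      body_term; body_guard; body_expr; body_cmd upper; body_unif upper;
      body_zero].

(** * The F program computes the reduction *)

Section Eval.
Variable upper : bool.
Local Notation P := (program upper).

Definition fcall (k : nat) (b r : tree) : Prop := eval P b (nth KLeaf P k) r.

Lemma eval_fcall a k e b r : eval P a e b -> fcall k b r ->
  eval P a (KCall k e) r.
Proof. exact: eval_call. Qed.

(** Symbolic execution: constructors and calls are peeled off, and for each call an [fcall] goal is
    left to its specification. *)
Ltac ev :=
  lazymatch goal with
  | |- eval _ _ (KCall _ _) _ =>
      eapply eval_fcall;
      [ev | cbn [sel left_tree right_tree Defs.tag]; rewrite ?sel_kquote]
  | |- eval _ _ (kapp _ _ _) _ => unfold kapp; ev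
  | |- eval _ _ (kadd _ _) _ => unfold kadd; ev
  | |- eval _ _ (kcompl _) _ => unfold kcompl; ev
  | |- eval _ _ (kif _ _ _) _ => unfold kif; ev
  | |- eval _ _ (ktag _ _) _ => unfold ktag; ev
  | |- eval _ _ (knatq _) _ => unfold knatq; ev
  | |- eval _ _ (karg_cmd _ _ _ _ _) _ => unfold karg_cmd; ev
  | |- eval _ _ (kret_const _) _ => exact: eval_kquote
  | |- eval _ _ (kquote _) _ => exact: eval_kquote
  | |- eval ?P ?a ?e _ =>
      first [ exact (@eval_sel P a e isT)
            | lazymatch e with KNode _ _ => eapply eval_node; ev end ]
  end.

Ltac sw := eapply eval_switch; [by [] | reflexivity | cbn [nth] | by []].

Lemma fcall_add m n :
  fcall f_add (Node (enc_nat m) (enc_nat n)) (enc_nat (m + n)).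
Proof.
elim: m => [|m IH]; rewrite /fcall /= /body_add.
  by apply: eval_ifs => //=; ev.
by apply: eval_ifs => //=; ev.
Qed.

Lemma fcall_eqn m n : fcall f_eqn (Node (enc_nat m) (enc_nat n))
  (if m == n then Node Leaf Leaf else Leaf).
Proof.
elim: m n => [|m IH] [|n]; rewrite /fcall /= /body_eqn;
  do 2 (apply: eval_ifs => //=); ev.
exact: IH.
Qed.

Lemma fcall_lookup x env : fcall f_lookup (Node (enc_nat x) (enc_env env))
  (enc_dtree (lookup env x)).
Proof.
elim: env => [|[y t] env IH]; rewrite /fcall /= /body_lookup.
  by apply: eval_ifs => //=; ev; apply: fcall_add.
apply: eval_ifs => //=.
case: ifPn => exy.
  apply: eval_if_node; last by ev.
  by ev; have := fcall_eqn x y; rewrite exy; apply.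
apply: eval_if_leaf; last by ev; apply: IH.
by ev; have := fcall_eqn x y; rewrite (negPf exy); apply.
Qed.

Lemma fcall_app_ret o p u :
  fcall f_app_ret (Node (enc_op o) (Node (enc_poly p) (enc_dtree u)))
    (enc_dtree (app_ret o p u)).
Proof.
elim: u => [q|c l IHl r IHr]; rewrite /fcall /= /body_app_ret.
  apply: eval_ifs => //=; case: o => /=;
    by sw; ev.
by apply: eval_ifs => //=; ev; [apply: IHl | apply: IHr].
Qed.

Lemma fcall_app o t u :
  fcall f_app (Node (enc_op o) (Node (enc_dtree t) (enc_dtree u)))
    (enc_dtree (app o t u)).
Proof.
elim: t => [p|c l IHl r IHr]; rewrite /fcall /= /body_app.
  by apply: eval_ifs => //=; ev; apply: fcall_app_ret.
by apply: eval_ifs => //=; ev; [apply: IHl | apply: IHr].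
Qed.

(** With the encodings as equations, trees that the program builds in place, which match an
    [enc_dtree] only after rewriting, can be supplied explicitly. *)
Lemma fcall_app_eq o t u b r :
  b = Node (enc_op o) (Node (enc_dtree t) (enc_dtree u)) ->
  r = enc_dtree (app o t u) -> fcall f_app b r.
Proof. by move=> -> ->; apply: fcall_app. Qed.

Lemma fcall_zero t :
  fcall f_zero (enc_dtree t) (enc_formula (zero_formula t)).
Proof.
elim: t => [p|c l IHl r IHr]; rewrite /fcall /= /body_zero.
  by apply: eval_ifs => //=; ev.
by apply: eval_ifs => //=; ev; [apply: IHl | apply: IHr].
Qed.

Lemma fcall_term t env : fcall f_term (Node (enc_term t) (enc_env env))
  (enc_dtree (comp_term t env)).
Proof.
elim: t => [q|x|s IHs u IHu|s IHs u IHu|s IHs u IHu];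
  rewrite /fcall /= /body_term; sw; ev;
  by first [apply: fcall_lookup | apply: IHs | apply: IHu | apply: fcall_app].
Qed.

Lemma fcall_guard phi env : fcall f_guard (Node (enc_guard phi) (enc_env env))
  (enc_dtree (comp_guard phi env)).
Proof.
elim: phi => [s u|psi IHs|psi IHs chi IHu];
  rewrite /fcall /= /body_guard; sw; ev;
  by first [apply: fcall_term | apply: IHs | apply: IHu | apply: fcall_app].
Qed.

Lemma fcall_expr f env : quantifier_free f ->
  fcall f_expr (Node (enc_expr f) (enc_env env)) (enc_dtree (comp_expr f env)).
Proof.
elim: f => //= [t _|phi g IHg /IHg{}IHg|q g IHg /IHg{}IHg
    |g IHg h IHh /andP[/IHg{}IHg /IHh{}IHh]];
  rewrite /fcall /= /body_expr; sw; ev;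
  by first [apply: fcall_term | apply: fcall_guard | apply: IHg | apply: IHh
           | apply: (fcall_app OMul (Ret (PConst _))) | apply: fcall_app].
Qed.

Section EvalCmd.
Variables (V : {fset nat}) (N : nat) (I : expr).
Hypothesis N_gt0 : (0 < N)%N.

Definition enc_cmd_arg (s : seq (cmd V term guard)) (env : seq (nat * dtree))
    (a b : nat) : tree :=
  Node (enc_stack s) (Node (Node (enc_expr I) (enc_nat N))
    (Node (enc_env env) (Node (enc_nat a) (enc_nat b)))).

(* The stack [s] is a defunctionalized representation of [K]. *)
Definition implements (s : seq (cmd V term guard)) (K : cont) : Prop :=
  forall env a b,
    fcall f_cmd (enc_cmd_arg s env a b) (enc_dtree (K env a b)).

Lemma enc_rat_nat n : enc_rat n%:Q = Node (enc_int n) (enc_int 1).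
Proof. by rewrite /enc_rat numq_int denq_int. Qed.

(** The fraction [1 / N] with [N] positive is already in lowest terms, so the program can write down
    its code directly. *)
Lemma enc_rat_inv : enc_rat (N%:Q^-1) = Node (enc_int 1) (enc_int N).
Proof.
have N0 : N%:Z != 0 by case: N N_gt0.
have <- : 1%:Q / N%:Q = N%:Q^-1 by rewrite mul1r.
rewrite /enc_rat coprimeq_num ?coprimeq_den ?coprime1n//= (negPf N0).
by rewrite gtr0_sg ?ltz_nat// mul1r.
Qed.

Lemma implements_unif s K x env i a b : implements s K ->
  fcall f_unif
    (Node (enc_nat i) (Node (enc_nat x) (enc_cmd_arg s env a b)))
    (enc_dtree (comp_unif upper N x K env i a b)).
Proof.
move=> sK; elim: i a b => [|i IH] a b; rewrite /fcall /= /body_unif.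
  by apply: eval_ifs => //=; ev.
apply: eval_ifs => //=; ev.
- exact: (fcall_add a a).
- exact: (fcall_add a a).
- exact: (fcall_add (a + a) b).
- exact: (sK ((x, Ret (PVar b)) :: env)).
- exact: (fcall_add a a).
- exact: (fcall_add a b).
- exact: IH.
- apply: (@fcall_app_eq OAdd
    (Ite (in_piece N i b) (K ((x, Ret (PVar b)) :: env) (a + a)%N (a + a + b)%N)
       (dconst upper))
    (comp_unif upper N x K env i (a + a)%N (a + b)%N)) => //.
  by rewrite /= !enc_rat_nat.
Qed.

(** Pushing a command on the stack mirrors composing its compilation with the continuation; for
    [Seq], the induction hypothesis for [C2] supplies the continuation with which the one for [C1]
    is used. *)
Lemma implements_cmd C s K : loop_free C -> implements s K ->
  implements (C :: s) (comp_cmd upper N C K).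
Proof.
elim: C s K => [||x t|phi|x|phi C1 IH1 C2 IH2|p C1 IH1 C2 IH2|C1 IH1 C2 IH2|//]
  s K lf sK env a b; rewrite /fcall /= /body_cmd; apply: eval_ifs => //=.
- by sw; ev; apply: sK.
- by sw; ev.
- sw; ev; first exact: fcall_term.
  exact: (sK ((val x, comp_term t env) :: env)).
- by sw; ev; [exact: fcall_guard | exact: sK | exact: fcall_app].
- sw; ev; first exact: (implements_unif (val x) _ _ _ _ sK).
  by apply: (@fcall_app_eq OMul (Ret (PConst (N%:Q^-1)))) => //;
    rewrite /= enc_rat_inv.
- case/andP: lf => lf1 lf2.
  sw; ev.
  + exact: fcall_guard.
  + exact: (IH1 _ _ lf1 sK).
  + exact: fcall_app.
  + exact: fcall_guard.
  + by apply: (@fcall_app_eq OMonus (Ret pone)).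
  + exact: (IH2 _ _ lf2 sK).
  + exact: fcall_app.
  + exact: fcall_app.
- case/andP: lf => lf1 lf2.
  sw; ev.
  + exact: (fcall_add a a).
  + exact: (IH1 _ _ lf1 sK env (a + a)%N b).
  + by apply: (@fcall_app_eq OMul (Ret (PConst p%:num))).
  + exact: (fcall_add a a).
  + exact: (fcall_add a b).
  + exact: (IH2 _ _ lf2 sK env (a + a)%N (a + b)%N).
  + by apply: (@fcall_app_eq OMul (Ret (PSub pone (PConst p%:num)))).
  + exact: fcall_app.
- case/andP: lf => lf1 lf2.
  sw; ev.
  exact: (IH1 _ _ lf1 (IH2 _ _ lf2 sK)).
Qed.

Lemma implements_nil : quantifier_free I ->
  implements [::] (fun env _ _ => comp_expr I env).
Proof.
move=> qI env a b; rewrite /fcall /= /body_cmd; apply: eval_ifs => //=.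
by ev; apply: fcall_expr.
Qed.

Lemma program_correct phi B f : loop_free B -> quantifier_free I ->
  quantifier_free f ->
  computes P (enc_input (@While V _ _ phi B) I f N)
    (enc_formula (reduction upper N phi B I f)).
Proof.
move=> lf qI qf; apply: eval_fcall; first exact: eval_arg.
have iB := implements_cmd lf (implements_nil qI) [::] 2 1.
rewrite /fcall /= /body_main /reduction /comp_step /comp_if.
set arg := enc_input _ _ _ _; set t := app OAdd _ _; set u := comp_expr I _.
set kt := kif _ _ _; set ku := KCall f_expr _.
have evt : eval P arg kt (enc_dtree t).
  rewrite /kt /t /arg /enc_input; ev.
  - exact: (fcall_guard phi [::]).
  - exact: iB.
  - exact: fcall_app.
  - exact: (fcall_guard phi [::]).
  - by apply: (@fcall_app_eq OMonus (Ret pone)).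
  - exact: (fcall_expr [::] qf).
  - exact: fcall_app.
  - exact: fcall_app.
have evu : eval P arg ku (enc_dtree u).
  by rewrite /ku /u /arg /enc_input; ev; apply: (fcall_expr [::] qI).
apply: eval_fcall (fcall_zero _).
have key (b : bool) : eval P arg (if b then kapp OLt ku kt else kapp OLt kt ku)
    (enc_dtree (if b then app OLt u t else app OLt t u)).
  case: b; rewrite /kapp.
    apply: eval_fcall (fcall_app _ _ _).
    by apply: eval_node; [apply: eval_kquote | apply: eval_node].
  apply: eval_fcall (fcall_app _ _ _).
  by apply: eval_node; [apply: eval_kquote | apply: eval_node].
exact: key.
Qed.
End EvalCmd.

End Eval.

(** * Values of decision trees *)

Section TreeValues.
Variable R : realType.
Implicit Types v : nat -> R.

Fixpoint dval (t : dtree) v : R :=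
  match t with
  | Ret p => poly_sem p v
  | Ite c l r => if `[< qf_holds c v >] then dval l v else dval r v
  end.

Definition op_sem (o : binop) (x y : R) : R :=
  match o with
  | OAdd => x + y
  | OMonus => Num.max (x - y) 0
  | OMul => x * y
  | OLt => (x < y)%R%:R
  end.

Lemma dval_app_ret o p u v : dval (app_ret o p u) v = op_sem o (poly_sem p v)
    (dval u v).
Proof.
elim: u => [q|c l IHl r IHr] /=; last by case: ifP.
case: o => //=; case: asboolP => /=; rewrite ?rmorph0 ?rmorph1.
- by move=> le; rewrite max_l // subr_ge0.
- by move=> /negP; rewrite -ltNge => lt; rewrite max_r // subr_le0 ltW.
- by move=> ->.
- by move=> /negP/negbTE ->.
Qed.

Lemma dval_app o t u v : dval (app o t u) v = op_sem o (dval t v) (dval u v).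
Proof.
elim: t => [p|c l IHl r IHr] /=; last by case: ifP.
exact: dval_app_ret.
Qed.

Lemma dval_compl t v (b : bool) : dval t v = b%:R -> dval (compl t)
    v = (~~ b)%:R.
Proof.
rewrite /compl dval_app /= rmorph1 => ->.
by case: b; rewrite /= ?subrr ?subr0 ?max_l.
Qed.

Lemma dval_if phi t u v (b : bool) : dval phi v = b%:R ->
  dval (comp_if phi t u) v = if b then dval t v else dval u v.
Proof.
move=> phib; have := dval_compl phib; rewrite /comp_if !dval_app /= phib => ->.
by case: b {phib}; rewrite /= !(mul0r, mul1r, addr0, add0r).
Qed.

Lemma zero_formulaP (t : dtree) v : qf_holds (zero_formula t) v <->
    dval t v = 0.
Proof.
elim: t => [p|c l IHl r IHr] /=; first by rewrite rmorph0.
by case: asboolP => h; rewrite -?IHl -?IHr; tauto.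
Qed.

Definition env_val (env : seq (nat * dtree)) v : nat -> R :=
  fun x => dval (lookup env x) v.

Lemma comp_termP (t : term) env v (s : nat -> {nonneg R}) :
  (forall x, (x \in term_fv t)%fset -> env_val env v x = (s x)%:num) ->
  dval (comp_term t env) v = (term_sem t s)%:num.
Proof.
elim: t => [q _|x|t IHt u IHu|t IHt u IHu|t IHt u IHu] //= h.
1: by apply: h; rewrite inE.
all: rewrite dval_app IHt ?IHu // => x xt; apply: h; by rewrite inE xt ?orbT.
Qed.

Lemma comp_guardP phi env v (s : nat -> {nonneg R}) :
  (forall x, (x \in guard_fv phi)%fset -> env_val env v x = (s x)%:num) ->
  dval (comp_guard phi env) v = (guard_sem phi s)%:R.
Proof.
elim: phi => [t u|psi IH|psi IHp chi IHc] /= h.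
- by rewrite dval_app /= !(@comp_termP _ _ _ s) // => x xt; apply: h;
    rewrite inE xt ?orbT.
- by apply: dval_compl; apply: IH.
- rewrite dval_app /= IHp ?IHc // => [|x xt|x xt]; last 2 first.
  + by apply: h; rewrite inE xt ?orbT.
  + by apply: h; rewrite inE xt ?orbT.
  by case: guard_sem; rewrite ?(mul1r, mul0r).
Qed.

Lemma comp_exprP f env v (s : nat -> {nonneg R}) : quantifier_free f ->
  (forall x, (x \in expr_fv f)%fset -> env_val env v x = (s x)%:num) ->
  (dval (comp_expr f env) v)%:E = expr_sem f s.
Proof.
elim: f => //= [t _|phi g IH qg|q g IH qg|g IHg h IHh /andP[qg qh]] fv.
- by rewrite (comp_termP fv).
- rewrite dval_app /= EFinM IH // => [|x xg]; last by apply: fv;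
    rewrite inE xg orbT.
  by rewrite (comp_guardP (s := s)) // => x xp; apply: fv; rewrite inE xp.
- by rewrite dval_app_ret /= EFinM IH.
- by rewrite dval_app /= EFinD IHg ?IHh // => x xf; apply: fv;
    rewrite inE xf ?orbT.
Qed.

(** Finiteness allows resolutions to be real-valued; infinite values can then enter only through
    optima. *)
Lemma expr_sem_fin f (s : nat -> {nonneg R}) : quantifier_free f ->
  (0 <= expr_sem f s)%E /\ expr_sem f s \is a fin_num.
Proof.
elim: f => //= [phi g IH /IH[g0 gf]|q g IH /IH[g0 gf]
    |g IHg h IHh /andP[/IHg[g0 gf] /IHh[h0 hf]]].
- by split; [apply: mule_ge0; rewrite // lee_fin ler0n | apply: fin_numM].
- by split; [apply: mule_ge0; rewrite // lee_fin ler0q | apply: fin_numM].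
- by split; [apply: adde_ge0 | rewrite fin_numD gf hf].
Qed.

End TreeValues.

(** * Resolving the nondeterminism of the Riemann transformers *)

Section Streams.
Variable R : realType.
Implicit Types w : nat -> R.

Definition evens w : nat -> R := fun i => w (i + i)%N.
Definition odds w : nat -> R := fun i => w (i + i).+1.
Definition interleave w w' : nat -> R :=
  fun i => if odd i then w' i./2 else w i./2.

Lemma evens_interleave w w' : evens (interleave w w') = w.
Proof.
by apply/funext => i; rewrite /evens /interleave addnn odd_double doubleK.
Qed.

Lemma odds_interleave w w' : odds (interleave w w') = w'.
Proof.
by apply/funext => i; rewrite /odds /interleave addnn /= odd_double
    uphalf_double.
Qed.

Definition optimum (upper : bool) (F : (nat -> R) -> R) : \bar R :=
  if upper then ereal_sup (range (fun w => (F w)%:E))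
  else ereal_inf (range (fun w => (F w)%:E)).

Lemma optimum_upper_ge F w : ((F w)%:E <= optimum true F)%E.
Proof. by apply: ereal_sup_ubound; exists w. Qed.

Lemma optimum_lower_le F w : (optimum false F <= (F w)%:E)%E.
Proof. by apply: ereal_inf_lbound; exists w. Qed.

Lemma optimum_upperP F (y : \bar R) :
  (optimum true F <= y)%E <-> (forall w, ((F w)%:E <= y)%E).
Proof.
split=> h; first by move=> w; apply: le_trans (optimum_upper_ge F w) h.
by apply: ge_ereal_sup => _ [w _ <-].
Qed.

Lemma optimum_lowerP F (y : \bar R) :
  (y <= optimum false F)%E <-> (forall w, (y <= (F w)%:E)%E).
Proof.
split=> h; first by move=> w; apply: le_trans h (optimum_lower_le F w).
by apply: le_ereal_inf_tmp => _ [w _ <-].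
Qed.

Lemma optimum_lowerE F : optimum false F = (- optimum true (fun w =>
    (- F w)%R))%E.
Proof.
by rewrite /optimum ereal_infEN image_comp.
Qed.

Lemma optimum_cst upper c : optimum upper (fun=> c) = c%:E.
Proof.
case: upper => /=; first by apply: ereal_sup_cst; apply/set0P; exists (fun=> 0).
by apply: ereal_inf_cst; apply/set0P; exists (fun=> 0).
Qed.

Lemma optimum_scale upper c F : 0 <= c ->
  optimum upper (fun w => c * F w) = (c%:E * optimum upper F)%E.
Proof.
rewrite le_eqVlt => /predU1P[<-|c0].
  rewrite mul0e; apply: etrans (optimum_cst upper 0); congr (optimum _ _).
  by apply/funext => w; rewrite mul0r.
by case: upper; rewrite /optimum -(ereal_sup_pZl, ereal_inf_pZl) // image_comp.
Qed.

(** The two halves of a stream are independent: [interleave] realizes every pair of streams, so [F]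
    and [G] can be optimized separately. *)
Lemma optimum_split_upper F G :
  optimum true (fun w => F (evens w) + G (odds w)) =
  (optimum true F + optimum true G)%E.
Proof.
apply/eqP; rewrite eq_le; apply/andP; split.
  by apply/optimum_upperP => w; rewrite EFinD; apply: leeD;
      apply: optimum_upper_ge.
set M := leRHS.
have FG w w' : ((F w)%:E + (G w')%:E <= M)%E.
  have := optimum_upper_ge (fun w => F (evens w) + G (odds w))
      (interleave w w').
  by rewrite /= evens_interleave odds_interleave EFinD.
(* Once [M] is known to be finite, so is the supremum of [G], and both can be moved across
   inequalities by subtraction. *)
have [->|Moo] := eqVneq M +oo%E; first by rewrite leey.
have Mfin : M \is a fin_num.
  rewrite fin_numE Moo andbT; apply/eqP => Mno.
  by have := FG (fun=> 0) (fun=> 0); rewrite Mno -EFinD leeNy_eq.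
have GM w : (optimum true G <= M - (F w)%:E)%E.
  by apply/optimum_upperP => w'; rewrite leeBrDr // addeC.
have Gfin : optimum true G \is a fin_num.
  rewrite fin_numE; apply/andP; split.
    apply/eqP => Gno; have := optimum_upper_ge G (fun=> 0).
    by rewrite Gno leeNy_eq.
  apply/eqP => Goo; have := GM (fun=> 0); rewrite Goo leye_eq => /eqP.
  by move: Mfin; case: (M).
rewrite -leeBrDr //; apply/optimum_upperP => w.
by rewrite leeBrDr // addeC -leeBrDr.
Qed.

Lemma optimum_split upper F G :
  optimum upper (fun w => F (evens w) + G (odds w)) =
  (optimum upper F + optimum upper G)%E.
Proof.
case: upper; first exact: optimum_split_upper.
rewrite !optimum_lowerE -oppeD.
  rewrite -optimum_split_upper; congr (- optimum _ _)%E.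
  by apply/funext => w; rewrite opprD.
(* Negation distributes over the sum because no term is -oo: a supremum over all streams of real
   values lies above one of them. *)
have ninf H : optimum true H != -oo%E.
  by apply/eqP => h; have := optimum_upper_ge H (fun=> 0); rewrite h leeNy_eq.
by rewrite /adde_def !(negPf (ninf _)) !andbF.
Qed.

End Streams.

Section Resolution.
Variables (R : realType) (V : {fset nat}).
Implicit Types (s : state R V) (w v : nat -> R).

(* A value that depends on the outcomes of all samples still to be drawn, which
   are given as a stream. *)
Definition resolution : Type := state R V -> (nat -> R) -> R.

Variables (upper : bool) (N : nat).
Hypothesis N_gt0 : (0 < N)%N.

Let N0 : (0 : R) < N%:R.
Proof. by rewrite ltr0n. Qed.

(** One constant in three roles: the value of [Diverge], the value of a choice outside its piece,
    and the start of the Kleene iteration. *)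
Definition neutral : R := if upper then 0 else 1.

Definition in_piece_sem (i : nat) (z : R) : bool :=
  (i%:R <= N%:R * z) && (N%:R * z <= i.+1%:R).

(** Every piece has its own sample, since a sum of suprema optimizes each piece separately. The head
    of the stream is the sample for the current piece, the rest of the even half feeds [k], and the
    odd half is left to the remaining pieces. *)
Fixpoint resolve_unif (x : V) (k : resolution) (i : nat) : resolution :=
  fun s w =>
  match i with
  | 0 => 0
  | j.+1 =>
      (if in_piece_sem j (w 0%N) then
         k (upd s x `|w 0%N|%:nng) (fun i => w (i + i).+2)
       else neutral) + resolve_unif x k j s (odds w)
  end.

Fixpoint resolve (C : cmd V term guard) (k : resolution) : resolution :=
  fun s w =>
  match C with
  | Skip => k s w
  | Diverge => neutral
  | Assign x t => k (upd s x (term_sem t (ext s))) w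
  | Observe phi => (guard_sem phi (ext s))%:R * k s w
  | Unif x => N%:R^-1 * resolve_unif x k N s w
  | If phi C1 C2 =>
      if guard_sem phi (ext s) then resolve C1 k s w else resolve C2 k s w
  | PChoice p C1 C2 =>
      ratr p%:num * resolve C1 k s (evens w)
      + (1 - ratr p%:num) * resolve C2 k s (odds w)
  | Seq C1 C2 => resolve C1 (resolve C2 k) s w
  | While _ _ => 0
  end.

(** * Correctness of the compilation *)

Definition env_agrees (env : seq (nat * dtree)) v s : Prop :=
  forall x : V, env_val env v (val x) = (s x)%:num.

Lemma ext_val s (x : V) : ext s (val x) = s x.
Proof. by rewrite /ext valK. Qed.

Lemma env_agrees_ext env v s (A : {fset nat}) : env_agrees env v s ->
  (A `<=` V)%fset ->
  forall x, (x \in A)%fset -> env_val env v x = (ext s x)%:num.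
Proof.
move=> es /fsubsetP AV x xA.
by have := es [` AV x xA]%fset; rewrite -ext_val.
Qed.

Lemma env_agrees_upd env v s (x : V) t (xi : {nonneg R}) :
  env_agrees env v s -> dval t v = xi%:num ->
  env_agrees ((val x, t) :: env) v (upd s x xi).
Proof.
move=> es tv y; rewrite /env_val /upd /=.
by have := es y; rewrite /env_val (inj_eq val_inj); case: ifP.
Qed.

Definition stream (a b : nat) v : nat -> R := fun i => v (a * i + b)%N.

Lemma evens_stream a b v : evens (stream a b v) = stream (a + a) b v.
Proof. by apply/funext => i; rewrite /evens /stream mulnDr mulnDl. Qed.

Lemma odds_stream a b v : odds (stream a b v) = stream (a + a) (a + b) v.
Proof.
by apply/funext => i; rewrite /odds /stream mulnS mulnDr mulnDl; congr v; lia.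
Qed.

Lemma stream_skip2 a b v :
  (fun i => stream a b v (i + i).+2) = stream (a + a) (a + a + b) v.
Proof.
by apply/funext => i; rewrite /stream !mulnS mulnDr mulnDl; congr v; lia.
Qed.

Definition realizes (K : cont) (k : resolution) : Prop :=
  forall env a b v s, env_agrees env v s ->
    dval (K env a b) v = k s (stream a b v).

Lemma realizes_unif K k x i : realizes K k ->
  realizes (comp_unif upper N (val x) K ^~ i) (resolve_unif x k i).
Proof.
move=> Kk; elim: i => [|i IH] env a b v s es; first by rewrite /= rmorph0.
have wb : stream a b v 0%N = v b by rewrite /stream muln0.
apply: etrans (dval_app OAdd (Ite _ _ _)
  (comp_unif upper N (val x) K env i _ _) v) _.
rewrite /= odds_stream -(IH env) //; congr (_ + _).
rewrite !ratr_nat wb.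
have -> : `[< i%:R <= N%:R * v b /\ N%:R * v b <= i.+1%:R >]
    = in_piece_sem i (v b).
  by apply/asboolP/andP.
case: ifP => [/andP[iz _]|_]; last by rewrite /neutral; case: upper;
    rewrite ?rmorph0 ?rmorph1.
rewrite stream_skip2; apply: Kk; apply: env_agrees_upd => //=.
(* A sample inside its piece is nonnegative, so the absolute value in [resolve_unif] changes
   nothing. *)
rewrite ger0_norm // -(pmulr_rge0 _ N0).
exact: le_trans (ler0n _ i) iz.
Qed.

Lemma dval_mul_const q t v :
  dval (app OMul (Ret (PConst q)) t) v = ratr q * dval t v.
Proof. exact: dval_app. Qed.

Lemma realizes_cmd K k C : loop_free C -> pwhile C -> realizes K k ->
  realizes (comp_cmd upper N C K) (resolve C k).
Proof.
elim: C K k => [||x t|phi|x|phi C1 IH1 C2 IH2|p C1 IH1 C2 IH2|C1 IH1 C2 IH2|//]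
  K k lf pw Kk env a b v s es.
- exact: Kk.
- by rewrite /= /neutral; case: upper; rewrite ?rmorph0 ?rmorph1.
- apply: Kk; apply: env_agrees_upd => //.
  exact/comp_termP/(env_agrees_ext es).
- rewrite [comp_cmd _ _ _ _]/= dval_app (Kk _ _ _ _ _ es).
  by rewrite (comp_guardP (s := ext s)) //; apply: (env_agrees_ext es).
- apply: etrans (dval_mul_const _ _ _) _.
  rewrite (realizes_unif _ _ Kk _ _ es) /=; congr (_ * _).
  by rewrite fmorphV /= ratr_int.
- move: lf pw => /= /andP [lf1 lf2] /and3P [pphi pw1 pw2].
  rewrite (@dval_if _ _ _ _ _ (guard_sem phi (ext s))).
    by rewrite (IH1 _ _ lf1 pw1 Kk _ _ _ _ _ es)
        (IH2 _ _ lf2 pw2 Kk _ _ _ _ _ es).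
  exact/comp_guardP/(env_agrees_ext es).
- move: lf pw => /= /andP [lf1 lf2] /andP [pw1 pw2].
  rewrite [RHS]/= evens_stream odds_stream.
  rewrite -(IH1 _ _ lf1 pw1 Kk _ _ _ _ _ es) -(IH2 _ _ lf2 pw2 Kk _ _ _ _ _ es).
  rewrite [LHS]/= dval_app !dval_app_ret.
  apply: (congr2 +%R) => //; apply: (congr2 *%R) => //.
  exact: (congr1 (fun z => z - _) (rmorph1 _)).
- move: lf pw => /= /andP [lf1 lf2] /andP [pw1 pw2].
  exact: (IH1 _ _ lf1 pw1 (IH2 _ _ lf2 pw2 Kk)).
Qed.

(** * Correctness of the resolution *)

(* Under this condition the neutral values of out-of-range choices do not affect
   the supremum (infimum). *)
Definition dominated_by_neutral (k : resolution) : Prop :=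
  forall s w, if upper then 0 <= k s w else k s w <= 1.

Definition riemann_unif : V -> exptn R V -> exptn R V :=
  if upper then upper_unif N else lower_unif N.

Definition piece_value (i : nat) (x : V) (f : exptn R V) : exptn R V := fun s =>
  let A := [set f (upd s x xi) | xi in rseg (i%:R / N%:R) (i.+1%:R / N%:R)] in
  if upper then ereal_sup A else ereal_inf A.

Lemma riemann_unifE x f s :
  riemann_unif x f s = ((N%:R^-1)%:E * \sum_(i < N) piece_value i x f s)%E.
Proof. by rewrite /riemann_unif /piece_value; case: upper. Qed.

Lemma in_pieceP i (xi : R) :
  in_piece_sem i xi = (i%:R / N%:R <= xi <= i.+1%:R / N%:R).
Proof. by rewrite ler_pdivrMr // ler_pdivlMr // mulrC. Qed.

(** Every value of [k] at a sample in the piece is attained by the stream with that sample as head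
    ([Fin]); conversely a stream yields such a value or the neutral one ([Fout]). The neutral value
    is beaten by any value at the left endpoint [z0], which lies in the piece. *)
Lemma piece_value_resolve i x k s : dominated_by_neutral k ->
  piece_value i x (fun s' => optimum upper (k s')) s =
  optimum upper (fun w => if in_piece_sem i (w 0%N) then
      k (upd s x `|w 0%N|%:nng) (fun i => w i.+1) else neutral).
Proof.
move=> kdom.
set F := fun w : nat -> R => _.
pose z0 : {nonneg R} := NngNum (divr_ge0 (ler0n R i) (ler0n R N)).
have z0P : rseg (i%:R / N%:R) (i.+1%:R / N%:R) z0.
  by rewrite /rseg /= lexx ler_pM2r ?invr_gt0 // ler_nat leqnSn.
have Fin w (xi : {nonneg R}) : rseg (i%:R / N%:R) (i.+1%:R / N%:R) xi ->
    exists w', F w' = k (upd s x xi) w.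
  move=> xiP; exists (fun j => if j is j'.+1 then w j' else xi%:num).
  rewrite /F in_pieceP ifT //; congr k; congr upd; apply/val_inj => /=;
      exact: ger0_norm.
have Fout w : (exists2 xi : {nonneg R}, rseg (i%:R / N%:R) (i.+1%:R / N%:R) xi &
    exists w', F w = k (upd s x xi) w') \/ F w = neutral.
  rewrite /F; case: ifPn => [wi|_]; [left|by right].
  exists `|w 0%N|%:nng; last by eexists.
  have w0 : 0 <= w 0%N.
    by case/andP: wi => wi _; rewrite -(pmulr_rge0 _ N0) (le_trans _ wi).
  by rewrite /rseg /= ger0_norm // -in_pieceP.
rewrite /piece_value; move: kdom Fin Fout;
    rewrite /dominated_by_neutral /neutral.
case: upper => kdom Fin Fout; apply/eqP; rewrite eq_le; apply/andP; split.
- apply: ge_ereal_sup => _ [xi xiP <-]; apply/optimum_upperP => w.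
  have [w' <-] := Fin w xi xiP; exact: optimum_upper_ge.
- apply/optimum_upperP => w; have [[xi xiP [w' ->]]|->] := Fout w.
    apply: le_trans (optimum_upper_ge (k _) w') _.
    by apply: ereal_sup_ubound; exists xi.
  apply: (@le_trans _ _ (k (upd s x z0) (fun=> 0))%:E);
      first by rewrite lee_fin.
  apply: le_trans (optimum_upper_ge (k _) (fun=> 0)) _.
  by apply: ereal_sup_ubound; exists z0.
- apply/optimum_lowerP => w; have [[xi xiP [w' ->]]|->] := Fout w.
    apply: le_trans (optimum_lower_le (k _) w').
    by apply: ereal_inf_lbound; exists xi.
  apply: (@le_trans _ _ (k (upd s x z0) (fun=> 0))%:E); last by rewrite lee_fin.
  apply: le_trans (optimum_lower_le (k _) (fun=> 0)).
  by apply: ereal_inf_lbound; exists z0.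
- apply: le_ereal_inf_tmp => _ [xi xiP <-]; apply/optimum_lowerP => w.
  have [w' <-] := Fin w xi xiP; exact: optimum_lower_le.
Qed.

Lemma sum_piece_value x k s n : dominated_by_neutral k ->
  (\sum_(i < n) piece_value i x (fun s' => optimum upper (k s')) s)%E =
  optimum upper (resolve_unif x k n s).
Proof.
move=> kdom; elim: n => [|n IH]; first by rewrite big_ord0 optimum_cst.
rewrite big_ord_recr /= IH piece_value_resolve // addeC.
rewrite -optimum_split; congr optimum; apply/funext => w.
congr (_ + _); rewrite /evens addn0; case: ifP => // _; congr k.
by apply/funext => i; rewrite addnS.
Qed.

Lemma i01_ratr (p : {i01 rat}) : 0 <= (ratr p%:num : R) <= 1.
Proof. by rewrite ler0q -(rmorph1 (ratr : rat -> R)) ler_rat ge0 le1. Qed.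

(** In the lower case each piece contributes at most 1; the factor [1 / N] later turns the bound [N]
    back into 1. *)
Lemma resolve_unif_dom x k n s w : dominated_by_neutral k ->
  if upper then 0 <= resolve_unif x k n s w else resolve_unif x k n s w <= n%:R.
Proof.
move=> kdom; elim: n w => [|n IH] w /=; first by case: upper.
have := IH (odds w); rewrite -natr1 [n%:R + 1]addrC /neutral.
have := kdom (upd s x `|w 0%N|%:nng) (fun i => w (i + i).+2).
case: in_piece_sem; case: upper => ? ?; rewrite ?add0r ?lerD2l //.
- exact: addr_ge0.
- exact: lerD.
Qed.

Lemma resolve_dom C k : loop_free C -> dominated_by_neutral k ->
  dominated_by_neutral (resolve C k).
Proof.
elim: C k => [||x t|phi|x|phi C1 IH1 C2 IH2|p C1 IH1 C2 IH2|C1 IH1 C2 IH2|//]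
  k lf kdom s w /=.
- exact: kdom.
- by rewrite /neutral; case: upper.
- exact: kdom.
- have := kdom s w; case: guard_sem; rewrite ?mul1r ?mul0r //.
  by case: upper.
- have := resolve_unif_dom x N s w kdom.
  case: upper => h; first by rewrite mulr_ge0 // invr_ge0 ltW.
  by rewrite mulrC ler_pdivrMr // mul1r.
- have /andP [lf1 lf2] := lf.
  by case: guard_sem; [apply: IH1 | apply: IH2].
- have /andP [lf1 lf2] := lf; have /andP [p0 p1] := i01_ratr p.
  have := IH1 k lf1 kdom s (evens w); have := IH2 k lf2 kdom s (odds w).
  by case: upper => ? ?; nra.
- have /andP [lf1 lf2] := lf.
  exact: (IH1 _ lf1 (IH2 _ lf2 kdom)).
Qed.

(** In a probabilistic choice both branches contribute, so the stream is split by [optimum_split];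
    in a conditional only one branch counts, and both may read the same stream. *)
Lemma transformer_resolve fixpt C k : loop_free C -> dominated_by_neutral k ->
  transformer neutral%:E fixpt riemann_unif (prog_den R C)
    (fun s => optimum upper (k s)) =
  (fun s => optimum upper (resolve C k s)).
Proof.
elim: C k => [||x t|phi|x|phi C1 IH1 C2 IH2|p C1 IH1 C2 IH2|C1 IH1 C2 IH2|//]
  k lf kdom; apply/funext => s /=.
- by [].
- by rewrite optimum_cst.
- by [].
- by rewrite optimum_scale ?ler0n.
- by rewrite riemann_unifE (sum_piece_value _ _ _ kdom)
    optimum_scale // invr_ge0 ltW.
- have /andP [lf1 lf2] := lf; rewrite IH1 // IH2 // /iverson.
  by case: guard_sem; rewrite /= mul1e mul0e ?adde0 ?add0e.
- have /andP [lf1 lf2] := lf; rewrite IH1 // IH2 //.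
  have /andP [p0 p1] := i01_ratr p.
  rewrite -optimum_scale // -optimum_scale ?subr_ge0 //.
  exact/esym/(optimum_split upper (fun w => _ * resolve C1 k s w)
    (fun w => _ * resolve C2 k s w)).
- have /andP [lf1 lf2] := lf; rewrite (IH2 _ lf2 kdom) (IH1 _ lf1) //.
  exact: resolve_dom.
Qed.

End Resolution.

(** * Validity of the formula and the invariant inequality *)

Section Reduction.
Variables (R : realType) (V : {fset nat}) (upper : bool) (N : nat).
Hypothesis N_gt0 : (0 < N)%N.

Definition riemann_transformer : prog R V -> exptn R V -> exptn R V :=
  transformer (neutral R upper)%:E (if upper then lfp (Exp (R:=R) (V:=V))
      else gfp (Exp1 (R:=R) (V:=V)))
    (riemann_unif upper N).

Definition loop_step (phi : guard) (B : cmd V term guard) (I f : expr) :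
    exptn R V := fun s =>
  (iverson R (guard_sem phi (ext s))
     * riemann_transformer (prog_den R B) (expr_den I) s
   + iverson R (~~ guard_sem phi (ext s)) * expr_den f s)%E.

Definition state_of_vals (v : nat -> R) : state R V :=
  fun x => NngNum (sqr_ge0 (v (val x + val x)%N)).

Lemma env_agrees_nil v : env_agrees (V := V) [::] v (state_of_vals v).
Proof. by move=> x. Qed.

(** Square roots undo the squares read by [lookup]. Hence every pair of a state and a stream of
    choices comes from an assignment of the real variables. *)
Definition vals_of (s : state R V) (w : nat -> R) : nat -> R :=
  interleave (fun i => Num.sqrt (ext s i)%:num) w.

Lemma state_of_valsK s w : state_of_vals (vals_of s w) = s.
Proof.
apply/funext => x; apply/val_inj => /=.
rewrite /vals_of /interleave addnn odd_double doubleK ext_val.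
exact: sqr_sqrtr.
Qed.

Lemma stream_vals_of s w : stream 2 1 (vals_of s w) = w.
Proof.
apply/funext => i; rewrite /stream /vals_of /interleave mul2n addn1 /=.
by rewrite odd_double /= uphalf_double.
Qed.

Lemma qf_validP F : qf_valid R F <-> forall v : nat -> R, qf_holds F v.
Proof.
rewrite /qf_valid /qf_nra /=; split => [h v|h [v]]; last exact.
by apply: contrapT => nF; apply: h; exists v.
Qed.

(** Quantifying over assignments amounts to quantifying over states and streams. For a fixed state,
    the inequality for all streams is the inequality for the optimum, which is the Riemann
    transformer of the body. *)
Lemma reductionP phi B I f :
  pwhile (While phi B) -> loop_free B ->
  syntactic_expectation V I -> syntactic_expectation V f ->
  quantifier_free I -> quantifier_free f ->
  (forall s, upper || (expr_den I (s : state R V) <= 1)%E) ->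
  qf_valid R (reduction upper N phi B I f) <->
  if upper then ele (loop_step phi B I f) (expr_den I)
  else ele (expr_den I) (loop_step phi B I f).
Proof.
move=> /andP[phiV pB] lfB IV fV qI qf I1.
pose k : resolution R V := fun s _ => fine (expr_den I s).
have kE : expr_den I = fun s => optimum upper (k s).
  apply/funext => s; rewrite optimum_cst fineK //.
  by have [] := expr_sem_fin (ext s) qI.
have kdom : dominated_by_neutral upper k.
  move=> s w; rewrite /k; have [I0 Ifin] := expr_sem_fin (ext s) qI.
  move: (I1 s); rewrite /expr_den; case: upper => /= [_|];
      first exact: fine_ge0.
  by rewrite -{1}(fineK Ifin) lee_fin.
have IE v : (dval (comp_expr I [::]) v)%:E = expr_den I (state_of_vals v).
  exact: comp_exprP qI (env_agrees_ext (env_agrees_nil v) IV).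
have fE v : (dval (comp_expr f [::]) v)%:E = expr_den f (state_of_vals v).
  exact: comp_exprP qf (env_agrees_ext (env_agrees_nil v) fV).
have realI : realizes (fun env _ _ => comp_expr I env) k.
  move=> env a b v s es; have [_ Ifin] := expr_sem_fin (ext s) qI.
  rewrite /k /expr_den; apply: EFin_inj; rewrite (fineK Ifin).
  exact: comp_exprP qI (env_agrees_ext es IV).
have stepE v : dval (comp_step upper N phi B I f) v =
    if guard_sem phi (ext (state_of_vals v)) then
      resolve upper N B k (state_of_vals v) (stream 2 1 v)
    else dval (comp_expr f [::]) v.
  rewrite (@dval_if _ _ _ _ _ (guard_sem phi (ext (state_of_vals v)))).
    congr (if _ then _ else _).
    exact: (realizes_cmd upper N_gt0 lfB pB realI 2 1 (env_agrees_nil v)).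
  exact/comp_guardP/(env_agrees_ext (env_agrees_nil v)).
have lsE s : loop_step phi B I f s =
    if guard_sem phi (ext s) then optimum upper (resolve upper N B k s)
        else expr_den f s.
  rewrite /loop_step /riemann_transformer {1}kE transformer_resolve // /iverson.
  by case: guard_sem; rewrite /= mul1e mul0e ?adde0 ?add0e.
apply: (iff_trans (qf_validP _)); rewrite /reduction.
have -> : (forall v : nat -> R, qf_holds (zero_formula
    (if upper then app OLt (comp_expr I [::]) (comp_step upper N phi B I f)
     else app OLt (comp_step upper N phi B I f) (comp_expr I [::]))) v) <->
  (forall v : nat -> R,
    if upper then dval (comp_step upper N phi B I f)
        v <= dval (comp_expr I [::]) v
    else dval (comp_expr I [::]) v <= dval (comp_step upper N phi B I f) v).
  have ltP (x y : R) : (x < y)%R%:R = 0 :> R <-> y <= x.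
    by rewrite leNgt; case: (x < y)%R; split=> // /eqP; rewrite oner_eq0.
  split=> h v; have := h v; rewrite zero_formulaP; case: upper;
    by rewrite dval_app /= ltP.
move: IE fE stepE lsE {I1 kE kdom}.
case: upper => IE fE stepE lsE; split.
- move=> h s; rewrite lsE; case: ifPn => phis.
    apply/optimum_upperP => w.
    have := h (vals_of s w); rewrite stepE stream_vals_of state_of_valsK phis.
    by rewrite -lee_fin IE state_of_valsK.
  have := h (vals_of s (fun=> 0)); rewrite stepE state_of_valsK (negPf phis).
  by rewrite -lee_fin IE fE state_of_valsK.
- move=> h v; rewrite -lee_fin IE; apply: le_trans (h _).
  rewrite stepE lsE; case: ifP => _; last by rewrite fE.
  exact: optimum_upper_ge.
- move=> h s; rewrite lsE; case: ifPn => phis.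
    apply/optimum_lowerP => w.
    have := h (vals_of s w); rewrite stepE stream_vals_of state_of_valsK phis.
    by rewrite -lee_fin IE state_of_valsK.
  have := h (vals_of s (fun=> 0)); rewrite stepE state_of_valsK (negPf phis).
  by rewrite -lee_fin IE fE state_of_valsK.
- move=> h v; rewrite -lee_fin IE; apply: le_trans (h _) _.
  rewrite stepE lsE; case: ifP => _; last by rewrite fE.
  exact: optimum_lower_le.
Qed.

End Reduction.

(** * Borel measurability on states *)

Section Borel.
Variables (R : realType) (V : {fset nat}).
Local Notation St := (g_sigma_algebraType (@state_open R V)).
Implicit Types s : state R V.

Lemma measurable_coord (x : V) : measurable_fun [set: St] (fun s : St =>
    (s x)%:num).
Proof.
apply: (measurability _ (RGenOpens.measurableE R)) => _ [_ [a [b ->] <-]].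
rewrite setTI; apply: sub_sigma_algebra.
exists ((fun g : {ptws V -> R} => g x) @^-1` `]a, b[%classic) => //.
apply: open_comp; last exact: interval_open.
by move=> g _; apply: proj_continuous.
Qed.

(** The boxes around [g] generate a filter that converges to [g] in every coordinate, hence in the
    product topology; so each open set around [g] contains a box. *)
Lemma state_open_box (O : set (state R V)) s : state_open O -> O s ->
  exists n : nat, forall s' : state R V,
    (forall x, `|(s' x)%:num - (s x)%:num| < n.+1%:R^-1) -> O s'.
Proof.
case=> W oW <- /= Ws.
set g : {ptws V -> R} := fun x => (s x)%:num.
pose box (n : nat) := [set h : V -> R | forall x, `|h x - g x| < n.+1%:R^-1].
pose F : set_system (V -> R) := filter_from setT box.
have FF : Filter F.
  apply: filter_from_filter; first by exists 0%N.
  move=> i j _ _; exists (maxn i j) => // h hb; split=> x.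
    apply: lt_le_trans (hb x) _.
    by rewrite lef_pV2 ?posrE ?ltr0n // ler_nat ltnS leq_maxl.
  apply: lt_le_trans (hb x) _.
  by rewrite lef_pV2 ?posrE ?ltr0n // ler_nat ltnS leq_maxr.
have Fg : F --> g.
  apply/cvg_sup => x A [_ [[U oU <-] Ug UA]].
  have /nbhs_ballP[e /= e0 eU] : nbhs (g x) U by apply: open_nbhs_nbhs.
  have [n ne] : exists n : nat, n.+1%:R^-1 < e.
    have [n _ /(_ n (leqnn _)) ne] := near_infty_natSinv_lt (PosNum e0).
    by exists n.
  exists n => // h hb; apply: UA; apply: eU; rewrite /ball /= distrC.
  exact: lt_trans (hb x) ne.
have [n _ nW] : F W by apply: Fg; apply: open_nbhs_nbhs.
by exists n => s' ss'; apply: nW.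
Qed.

(** States carry the Borel sets of the product topology, so coordinatewise measurability suffices
    only through second countability: an open set is a countable union of boxes with rational
    centres, and the preimage of a box is a finite intersection. *)
Lemma measurable_to_state d (T : measurableType d) (f : T -> state R V) :
  (forall x, measurable_fun [set: T] (fun t => (f t x)%:num)) ->
  measurable_fun [set: T] (f : T -> St).
Proof.
move=> mf.
apply: (@measurability _ _ T St setT (f : T -> St) (@state_open R V)) => //.
move=> _ [U oU <-]; rewrite setTI.
pose rbox (p : {ffun V -> rat} * nat) : set (state R V) :=
  [set s | forall x, `|(s x)%:num - ratr (p.1 x)| < p.2.+1%:R^-1].
have -> : f @^-1` U = \bigcup_p (if `[< rbox p `<=` U >]
    then f @^-1` rbox p else set0).
  apply/seteqP; split=> t; last first.
    by case=> p _; case: asboolP => // sub0; apply: sub0.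
  move=> /= Uft; have [n nU] := state_open_box oU Uft.
  (* Then [1 / m.+1] is half of [1 / n.+1]: the box around a rational point this close to [f t]
     stays in the larger box around [f t]. *)
  pose m := n.*2.+1.
  have m0 : (0 : R) < m.+1%:R^-1 by rewrite invr_gt0 ltr0n.
  have mn : m.+1%:R^-1 + m.+1%:R^-1 = n.+1%:R^-1 :> R.
    have -> : m.+1 = (2 * n.+1)%N by rewrite /m; lia.
    rewrite natrM invfM -mulrDl (_ : 2^-1 + 2^-1 = 1) ?mul1r //; lra.
  have /choice[q hq] (x : V) : exists q : rat,
      `|(f t x)%:num - ratr q| < m.+1%:R^-1.
    have tm : (f t x)%:num < (f t x)%:num + m.+1%:R^-1 by rewrite ltrDl.
    have [q] := rat_in_itvoo tm.
    rewrite in_itv /= => /andP[q1 q2]; exists q.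
    by rewrite distrC ltr_distl q2 andbT (lt_trans _ q1) // ltrBlDr ltrDl.
  exists ([ffun x => q x], m) => //.
  rewrite asboolT; first by move=> x /=; rewrite ffunE.
  move=> s' /= ss'; apply: nU => x.
  have := ss' x; rewrite ffunE => h1; have h2 := hq x.
  apply: le_lt_trans (ler_distD (ratr (q x)) _ _) _.
  by rewrite -mn ltrD // distrC.
apply: countable_bigcupT_measurable => // p.
case: asboolP => // _.
have -> : f @^-1` rbox p =
    \bigcap_(x in [set: V]) [set t | `|(f t x)%:num - ratr (p.1 x)| <
        p.2.+1%:R^-1].
  by apply/seteqP; split=> t h x; [move=> _; apply: (h x) | apply: (h x I)].
apply: fin_bigcap_measurable => [|x _]; first exact: finite_finset.
rewrite -[X in measurable X]setTI.
apply: (@measurable_fun_ltr _ _ _ _ _ (cst _) _ _ measurableT [set true]) => //.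
apply: measurableT_comp => //.
by apply: measurable_funB => //; apply: mf.
Qed.

Lemma measurable_term (t : term) :
  measurable_fun [set: St] (fun s : St => (term_sem t (ext s))%:num).
Proof.
elim: t => [q|x|t IHt u IHu|t IHt u IHu|t IHt u IHu] /=.
- exact: measurable_cst.
- rewrite /ext; case: insubP => [y _ _|_]; first exact: measurable_coord.
  exact: measurable_cst.
- exact: measurable_funD.
- by apply: measurable_maxr; [apply: measurable_funB | apply: measurable_cst].
- exact: measurable_funM.
Qed.

Lemma measurable_guard (phi : guard) :
  measurable_fun [set: St] (fun s : St => guard_sem phi (ext s)).
Proof.
elim: phi => [t u|psi IH|psi IHp chi IHc] /=.
- by apply: measurable_fun_ltr; apply: measurable_term.
- by have H := @measurable_neg _ _ _ _ IH; exact: H.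
- by have H := @measurable_and _ _ _ _ _ IHp IHc; exact: H.
Qed.

Lemma measurable_assign (x : V) (t : term) : measurable_fun [set: St]
  ((fun s : St => upd s x (term_sem t (ext s))) : St -> St).
Proof.
apply: measurable_to_state => y; rewrite /upd.
by case: (y == x); [apply: measurable_term | apply: measurable_coord].
Qed.

Definition sample (x : V) s (xi : R) : state R V := upd s x `|xi|%:nng.

Lemma measurable_sample (x : V) : measurable_fun [set: St * R]
  ((fun p : St * R => sample x p.1 p.2) : St * R -> St).
Proof.
apply: measurable_to_state => y; rewrite /sample /upd.
case: (y == x) => /=; first by apply: measurableT_comp => //;
    apply: measurable_snd.
by apply: (measurableT_comp (measurable_coord y)); apply: measurable_fst.
Qed.

Lemma measurable_sample_at (x : V) s : measurable_fun [set: R]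
  (sample x s : R -> St).
Proof.
apply: measurable_to_state => y; rewrite /sample /upd.
by case: (y == x) => /=; [apply: measurableT_comp | apply: measurable_cst].
Qed.

(** Tonelli: a nonnegative function that is jointly measurable in state and sample is integrated
    over the sample; an indicator restricts it to the unit interval. *)
Lemma Borel_lebesgue_unif (x : V) (f : exptn R V) : Borel_fun f ->
  (forall s, 0 <= f s)%E -> Borel_fun (lebesgue_unif x f).
Proof.
move=> mf f0; rewrite /Borel_fun /=.
pose h (p : St * R) :=
  (f (sample x p.1 p.2) * (\1_(`[0%R, 1%R]%classic : set R) p.2)%R%:E)%E.
have -> : lebesgue_unif x f = fubini_F (@lebesgue_measure R) h.
  apply/funext => s; rewrite /lebesgue_unif integral_mkcond /fubini_F.
  by rewrite epatch_indic.
apply: measurable_fun_fubini_tonelli_F => /=; last first.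
  by move=> p; apply: mule_ge0; rewrite ?lee_fin.
apply: emeasurable_funM.
  exact: (measurableT_comp mf (measurable_sample x)).
apply/measurable_EFinP; apply: measurableT_comp; last exact: measurable_snd.
exact: measurable_indic.
Qed.

Lemma measurable_iverson d (T : measurableType d) (b : T -> bool) :
  measurable_fun [set: T] b -> measurable_fun [set: T] (fun t =>
      iverson R (b t)).
Proof.
move=> mb; rewrite (_ : (fun t => _) = fun t => if b t then 1%E else 0%E).
  by apply: measurable_fun_ifT.
by apply/funext => t; rewrite /iverson; case: (b t).
Qed.

End Borel.

(** * Exact transformers of loop-free programs *)

Section UnifIntegral.
Variable R : realType.
Local Notation mu := (@lebesgue_measure R).
Local Open Scope ereal_scope.

Lemma measure_unit : mu `[0%R, 1%R] = 1.
Proof. by rewrite lebesgue_measure_itv /= lte_fin ltr01 sube0. Qed.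

Lemma integral_pieces (F : R -> \bar R) (N n : nat) : (0 < N)%N ->
  measurable_fun [set: R] F -> (forall xi, 0 <= F xi) ->
  \int[mu]_(xi in `[0%R, (n%:R / N%:R)%R[) F xi =
  \sum_(i < n) \int[mu]_(xi in `[(i%:R / N%:R)%R, (i.+1%:R / N%:R)%R[) F xi.
Proof.
move=> N0 mF F0; elim: n => [|n IH].
  by rewrite mul0r set_itvco0 integral_set0 big_ord0.
have N0' : (0 < N%:R :> R)%R by rewrite ltr0n.
rewrite big_ord_recr /= -IH.
rewrite (@itv_bndbnd_setU _ _ _ (BLeft (n%:R / N%:R)%R)); last 2 first.
- by rewrite bnd_simp divr_ge0.
- by rewrite bnd_simp ler_pM2r ?invr_gt0 // ler_nat.
rewrite ge0_integral_setU //=.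
- exact: measurable_funTS.
- rewrite disj_set2E; apply/eqP/seteqP; split=> // x [] /=.
  by rewrite !in_itv /= => /andP[_ xn] /andP[nx _]; rewrite ltNge nx in xn.
Qed.

Lemma measure_piece (N i : nat) : (0 < N)%N ->
  mu `[(i%:R / N%:R)%R, (i.+1%:R / N%:R)%R[ = (N%:R^-1)%:E.
Proof.
move=> N0; have N0' : (0 < N%:R :> R)%R by rewrite ltr0n.
rewrite lebesgue_measure_itv /= lte_fin ltr_pM2r ?invr_gt0 // ltr_nat ltnSn.
by rewrite -EFinB -mulrBl -natr1 addrAC subrr add0r mul1r.
Qed.

(** Half-open pieces are disjoint, which makes the integral additive; the point 1 that they miss is
    a null set. *)
Lemma integral_unit_pieces (F : R -> \bar R) (N : nat) : (0 < N)%N ->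
  measurable_fun [set: R] F -> (forall xi, 0 <= F xi) ->
  \int[mu]_(xi in `[0%R, 1%R]) F xi =
  \sum_(i < N) \int[mu]_(xi in `[(i%:R / N%:R)%R, (i.+1%:R / N%:R)%R[) F xi.
Proof.
move=> N0 mF F0; rewrite -integral_itv_bndo_bndc; last exact: measurable_funTS.
rewrite -integral_pieces // divff //; by rewrite pnatr_eq0 -lt0n.
Qed.

End UnifIntegral.

(** * Exact transformers: regularity, continuity, and comparison with the Riemann ones *)

Section Exact.
Variables (R : realType) (V : {fset nat}) (upper : bool) (N : nat).
Hypothesis N_gt0 : (0 < N)%N.
Implicit Types (f g : exptn R V) (s : state R V).
Local Open Scope ereal_scope.

(** With the order reversed in the lower case, subinvariants become superinvariants and greatest
    fixed points least ones. *)
Definition leu (x y : \bar R) : bool := if upper then x <= y else y <= x.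

Lemma leu_trans y x z : leu x y -> leu y z -> leu x z.
Proof. by rewrite /leu; case: upper => xy yz;
    [apply: le_trans yz | apply: le_trans xy]. Qed.

Lemma leu_refl x : leu x x. Proof. by rewrite /leu lexx; case: upper. Qed.

Lemma leu_add a b c d : leu a c -> leu b d -> leu (a + b) (c + d).
Proof. by rewrite /leu; case: upper; apply: leeD. Qed.

Lemma leu_scale (r : R) x y : (0 <= r)%R -> leu x y -> leu (r%:E * x)
    (r%:E * y).
Proof. by rewrite /leu => r0; case: upper => xy; apply: lee_wpmul2l. Qed.

(** A common form of [ExpM] and [Exp1M], see [admissibleP]. *)
Record admissible f : Prop := Admissible {
  adm_meas : Borel_fun f;
  adm_ge0 : forall s, 0 <= f s;
  adm_le1 : forall s, ~~ upper -> f s <= 1 }.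

Lemma measurable_section x s f : Borel_fun f ->
  measurable_fun [set: R] (fun xi => f (sample x s xi)).
Proof. by move=> mf; apply: (measurableT_comp mf (measurable_sample_at x s)).
    Qed.

Lemma lebesgue_unif_ge0 x f s : (forall s', 0 <= f s') ->
    0 <= lebesgue_unif x f s.
Proof. by move=> f0; apply: integral_ge0. Qed.

Lemma lebesgue_unif_le x f g s : Borel_fun f -> Borel_fun g ->
  (forall s', 0 <= f s') -> (forall s', f s' <= g s') ->
  lebesgue_unif x f s <= lebesgue_unif x g s.
Proof.
move=> mf mg f0 fg; apply: ge0_le_integral => //.
- by apply: measurable_funTS; apply: measurable_section.
- by apply: measurable_funTS; apply: measurable_section.
Qed.

Lemma lebesgue_unif_cst x c s : lebesgue_unif x (fun=> c) s = c.
Proof.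
apply: etrans (integral_cst _ _ c) _; first exact: measurable_itv.
by rewrite -[RHS]mule1; congr (_ * _); apply: measure_unit.
Qed.

Lemma admissible_neutral : admissible (fun=> (neutral R upper)%:E).
Proof.
split; first exact: measurable_cst.
- by move=> s; rewrite lee_fin /neutral; case: upper.
- by move=> s; rewrite lee_fin /neutral; case: upper.
Qed.

Lemma piece_value_ge0 i x s g : (forall s', 0 <= g s') ->
  0 <= piece_value upper N i x g s.
Proof.
move=> g0; rewrite /piece_value; case: upper; last first.
  by apply: le_ereal_inf_tmp => _ [xi _ <-].
have iP : rseg (i%:R / N%:R)%R (i.+1%:R / N%:R)%R
    (NngNum (divr_ge0 (ler0n R i) (ler0n R N))).
  by rewrite /rseg /= lexx ler_pM2r ?invr_gt0 ?ltr0n // ler_nat leqnSn.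
apply: le_trans (g0 _) _; apply: ereal_sup_ubound.
by eexists; [exact: iP | reflexivity].
Qed.

(** On a half-open piece, [f] is bounded by the constant [piece_value] of [g], whose integral
    carries the weight [1 / N]. Only this constant is integrated, so [g] may be the output of a
    Riemann transformer, about whose measurability nothing is known. *)
Lemma lebesgue_riemann x f g s : admissible f -> (forall s', 0 <= g s') ->
  (forall s', leu (f s') (g s')) ->
  leu (lebesgue_unif x f s) (riemann_unif upper N x g s).
Proof.
move=> [mf f0 _] g0 fg; rewrite riemann_unifE /lebesgue_unif.
have mF := measurable_section x s mf.
rewrite (integral_unit_pieces N_gt0 mF) //.
have piece_ge0 i := piece_value_ge0 i x s g0.
rewrite ge0_sume_distrr //.
apply: (big_ind2 leu) => [|a b c d|i _]; [exact: leu_refl|exact: leu_add|].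
rewrite -(measure_piece R i N_gt0) muleC -integral_cst //.
have fpiece xi : `[(i%:R / N%:R)%R, (i.+1%:R / N%:R)%R[%classic xi ->
    leu (f (sample x s xi)) (piece_value upper N i x g s).
  rewrite /= in_itv /= => /andP[ixi xii]; have := fg (sample x s xi).
  have xi0 : (0 <= xi)%R by apply: le_trans ixi; rewrite divr_ge0.
  have seg : rseg (i%:R / N%:R)%R (i.+1%:R / N%:R)%R `|xi|%:nng%R.
    by rewrite /rseg /= ger0_norm // ixi ltW.
  rewrite /leu /piece_value; case: upper => h.
    by apply: le_trans h _; apply: ereal_sup_ubound; eexists; [exact: seg|].
  by apply: le_trans h; apply: ereal_inf_lbound; eexists; [exact: seg|].
move: fpiece; rewrite /leu; case: upper piece_ge0 => piece_ge0 fpiece.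
- by apply: ge0_le_integral => //; apply: measurable_funTS.
- by apply: ge0_le_integral => //; [move=> ? _;
    apply: piece_ge0 | apply: measurable_funTS].
Qed.

(** Monotonicity is asked for in the upper case, where values are unbounded; in the lower case the
    constant 1 dominates, and it is integrable because the unit interval has measure 1. *)
Lemma cvg_lebesgue_unif x (f_ : nat -> exptn R V) f s :
  (forall n, admissible (f_ n)) -> admissible f ->
  (upper -> forall s', nondecreasing_seq (f_ ^~ s')) ->
  (forall s', f_ ^~ s' @ \oo --> f s') ->
  (fun n => lebesgue_unif x (f_ n) s) @ \oo --> lebesgue_unif x f s.
Proof.
move=> af_ af nd cf.
have mf_ n : measurable_fun (`[0%R, 1%R]%classic : set R) (fun xi : R =>
    f_ n (sample x s xi)).
  by apply: measurable_funTS; apply: measurable_section; case: (af_ n).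
case: (boolP upper) => up.
  have -> : lebesgue_unif x f s = \int[@lebesgue_measure R]_(xi in `[0%R, 1%R])
      limn (fun n => f_ n (sample x s xi)).
    by apply: eq_integral => xi _; apply/esym/cvg_lim => //; apply: cf.
  apply: cvg_monotone_convergence => //.
  - by move=> n xi _; case: (af_ n).
  - by move=> xi _ m n mn; apply: nd.
have [] := @dominated_convergence _ _ R (@lebesgue_measure R) `[0%R, 1%R]
  (measurable_itv _) (fun n xi => f_ n (sample x s xi))
  (fun xi => f (sample x s xi)) (cst 1) mf_ => //.
- by apply: measurable_funTS; apply: measurable_section; case: af.
- by apply: aeW => xi _; apply: cf.
- apply/integrableP; split; first exact: measurable_cst.
  rewrite (eq_integral (cst 1)); last by move=> xi _ /=; rewrite normr1.
  rewrite integral_cst // mul1e [X in X < _](_ : _ = 1) ?ltry //.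
  exact: measure_unit.
- apply: aeW => xi n _; have [_ f0 f1] := af_ n.
  by rewrite gee0_abs //; apply: f1.
Qed.

Variable fixpt : (exptn R V -> exptn R V) -> exptn R V.
Local Notation T C := (transformer (neutral R upper)%:E fixpt (@lebesgue_unif R
    V) (prog_den R C)).

Lemma i01_ratr_ge0 (p : {i01 rat}) :
  ((0 <= (ratr p%:num : R)) /\ (0 <= 1 - (ratr p%:num : R)))%R.
Proof. by have /andP[p0 p1] := i01_ratr R p; rewrite subr_ge0. Qed.

Lemma admissible_transformer C f : loop_free C -> admissible f ->
  admissible (T C f).
Proof.
elim: C f => [||x t|phi|x|phi C1 IH1 C2 IH2|p C1 IH1 C2 IH2|C1 IH1 C2 IH2|//]
  f lf af /=.
- exact: af.
- exact: admissible_neutral.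
- case: af => mf f0 f1; split=> //.
  + exact: (measurableT_comp mf (measurable_assign x t)).
  + by move=> s; apply: f1.
- case: af => mf f0 f1; split.
  + apply: emeasurable_funM => //.
    exact: (measurable_iverson (@measurable_guard R V phi)).
  + by move=> s; apply: mule_ge0 => //; rewrite lee_fin ler0n.
  + move=> s up; rewrite /iverson; case: guard_sem; rewrite /= ?mul1e ?mul0e //.
    exact: f1.
- case: af => mf f0 f1; split.
  + exact: Borel_lebesgue_unif.
  + by move=> s; apply: lebesgue_unif_ge0.
  + move=> s up; rewrite -[leRHS](lebesgue_unif_cst x 1 s).
    by apply: lebesgue_unif_le => // [|s']; [apply: measurable_cst | apply: f1].
- have /andP [lf1 lf2] := lf.
  have [m1 p1 q1] := IH1 f lf1 af; have [m2 p2 q2] := IH2 f lf2 af; split.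
  + apply: emeasurable_funD; apply: emeasurable_funM => //.
      exact: (measurable_iverson (@measurable_guard R V phi)).
    have H := @measurable_neg _ _ _ _ (@measurable_guard R V phi).
    exact: (measurable_iverson H).
  + by move=> s; apply: adde_ge0; apply: mule_ge0; rewrite // lee_fin ler0n.
  + move=> s up; rewrite /iverson.
    by case: guard_sem; rewrite /= mul1e mul0e ?adde0 ?add0e;
        [apply: q1 | apply: q2].
- have /andP [lf1 lf2] := lf; have [pp pq] := i01_ratr_ge0 p.
  have [m1 p1 q1] := IH1 f lf1 af; have [m2 p2 q2] := IH2 f lf2 af; split.
  + by apply: emeasurable_funD; apply: measurable_funeM.
  + by move=> s; apply: adde_ge0; apply: mule_ge0; rewrite // lee_fin.
  + move=> s up.
    have -> : 1 = (ratr p%:num)%:E * 1 + (1 - ratr p%:num)%:E * 1 :> \bar R.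
      by rewrite !mule1 -EFinD addrC subrK.
    by apply: leeD; apply: lee_wpmul2l; rewrite ?lee_fin //;
        [apply: q1 | apply: q2].
- by have /andP [lf1 lf2] := lf; apply: IH1 => //; apply: IH2.
Qed.

Lemma transformer_mono C f g : loop_free C -> admissible f -> admissible g ->
  (forall s, f s <= g s) -> forall s, T C f s <= T C g s.
Proof.
elim: C f g => [||x t|phi|x|phi C1 IH1 C2 IH2|p C1 IH1 C2 IH2|C1 IH1 C2 IH2|//]
  f g lf af ag fg s /=.
- exact: fg.
- by [].
- exact: fg.
- by apply: lee_wpmul2l => //; rewrite lee_fin ler0n.
- by case: af => mf f0 _; case: ag => mg _ _; apply: lebesgue_unif_le.
- have /andP [lf1 lf2] := lf.
  by apply: leeD; apply: lee_wpmul2l; rewrite ?lee_fin ?ler0n //;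
      [apply: IH1 | apply: IH2].
- have /andP [lf1 lf2] := lf; have [pp pq] := i01_ratr_ge0 p.
  by apply: leeD; apply: lee_wpmul2l; rewrite ?lee_fin //;
      [apply: IH1 | apply: IH2].
- have /andP [lf1 lf2] := lf.
  apply: (IH1 _ _ lf1 _ _ (IH2 _ _ lf2 af ag fg));
    exact: admissible_transformer.
Qed.

(** Nonnegativity is carried along in the induction: in [Seq], the Riemann value of [C2] becomes the
    [g] of the hypothesis for [C1]. *)
Lemma transformer_riemann fixpt' C f g : loop_free C -> admissible f ->
  (forall s, 0 <= g s) -> (forall s, leu (f s) (g s)) ->
  let T' := transformer (neutral R upper)%:E fixpt' (riemann_unif upper N)
    (prog_den R C) in
  (forall s, 0 <= T' g s) /\ forall s, leu (T C f s) (T' g s).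
Proof.
elim: C f g => [||x t|phi|x|phi C1 IH1 C2 IH2|p C1 IH1 C2 IH2|C1 IH1 C2 IH2|//]
  f g lf af g0 fg /=.
- by [].
- by split=> s; [exact: (adm_ge0 admissible_neutral s) | apply: leu_refl].
- by [].
- split=> s; first by apply: mule_ge0 => //; rewrite lee_fin ler0n.
  by apply: leu_scale => //; rewrite ler0n.
- split=> s; last exact: lebesgue_riemann.
  rewrite riemann_unifE; apply: mule_ge0;
      first by rewrite lee_fin invr_ge0 ler0n.
  by apply: sume_ge0 => i _; apply: piece_value_ge0.
- have /andP [lf1 lf2] := lf.
  have [p1 q1] := IH1 f g lf1 af g0 fg; have [p2 q2] := IH2 f g lf2 af g0 fg.
  split=> s; first by apply: adde_ge0; apply: mule_ge0;
      rewrite // lee_fin ler0n.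
  by apply: leu_add; apply: leu_scale; rewrite ?ler0n.
- have /andP [lf1 lf2] := lf; have [pp pq] := i01_ratr_ge0 p.
  have [p1 q1] := IH1 f g lf1 af g0 fg; have [p2 q2] := IH2 f g lf2 af g0 fg.
  split=> s; first by apply: adde_ge0; apply: mule_ge0; rewrite // lee_fin.
  by apply: leu_add; apply: leu_scale.
- have /andP [lf1 lf2] := lf.
  have [p2 q2] := IH2 f g lf2 af g0 fg.
  by apply: IH1 => //; apply: admissible_transformer.
Qed.

Lemma transformer_cvg C (f_ : nat -> exptn R V) f : loop_free C ->
  (forall n, admissible (f_ n)) -> admissible f ->
  (upper -> forall s, nondecreasing_seq (f_ ^~ s)) ->
  (forall s, f_ ^~ s @ \oo --> f s) ->
  forall s, (fun n => T C (f_ n) s) @ \oo --> T C f s.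
Proof.
elim: C f_ f => [||x t|phi|x|phi C1 IH1 C2 IH2|p C1 IH1 C2 IH2|C1 IH1 C2 IH2|//]
  f_ f lf af_ af nd cf s /=.
- exact: cf.
- exact: cvg_cst.
- exact: cf.
- by apply: cvgeZl.
- exact: cvg_lebesgue_unif.
- have /andP [lf1 lf2] := lf.
  have [_ p1 _] := admissible_transformer lf1 af.
  have [_ p2 _] := admissible_transformer lf2 af.
  apply: cvgeD; last 2 first.
  + by apply: cvgeZl => //; apply: IH1.
  + by apply: cvgeZl => //; apply: IH2.
  + by apply: ge0_adde_def; rewrite inE; apply: mule_ge0;
      rewrite // lee_fin ler0n.
- have /andP [lf1 lf2] := lf; have [pp pq] := i01_ratr_ge0 p.
  have [_ p1 _] := admissible_transformer lf1 af.
  have [_ p2 _] := admissible_transformer lf2 af.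
  apply: cvgeD; last 2 first.
  + by apply: cvgeZl => //; apply: IH1.
  + by apply: cvgeZl => //; apply: IH2.
  + by apply: ge0_adde_def; rewrite inE; apply: mule_ge0; rewrite // lee_fin.
- have /andP [lf1 lf2] := lf.
  apply: IH1 => //.
  + by move=> n; apply: admissible_transformer.
  + exact: admissible_transformer.
  + move=> up s' m n mn; apply: transformer_mono => // s''.
    exact: nd.
  + by move=> s'; apply: IH2.
Qed.

End Exact.

(** * Loops *)

Section Loops.
Variables (R : realType) (V : {fset nat}) (upper : bool) (N : nat).
Hypothesis N_gt0 : (0 < N)%N.
Implicit Types (f g Y Z : exptn R V) (s : state R V).
Local Open Scope ereal_scope.

Definition exact_fixpt : (exptn R V -> exptn R V) -> exptn R V :=
  if upper then lfp (ExpM (R:=R) (V:=V)) else gfp (Exp1M (R:=R) (V:=V)).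

Definition exact_transformer : prog R V -> exptn R V -> exptn R V :=
  transformer (neutral R upper)%:E exact_fixpt (@lebesgue_unif R V).

Lemma admissibleP f : admissible upper f <->
  (if upper then ExpM (R:=R) (V:=V) else Exp1M (R:=R) (V:=V)) f.
Proof.
case: upper; split=> [[mf f0 f1]|[f01 mf]].
- by split.
- by split.
- by split=> // s; rewrite f0 f1.
- by split=> // s; [have /andP[] := f01 s | have /andP[] := f01 s].
Qed.

(** [xget] falls back to its default unless an extremal fixed point exists. Here [Y] witnesses
    existence, and the selected fixed point is compared with [Y] by its own extremality. *)
Lemma exact_fixpt_least (Phi : exptn R V -> exptn R V) Y :
  admissible upper Y -> Phi Y = Y ->
  (forall Z, admissible upper Z -> Phi Z = Z -> forall s, leu upper (Y s)
      (Z s)) ->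
  forall s, leu upper (exact_fixpt Phi s) (Y s).
Proof.
move=> /admissibleP aY fY lY; rewrite /exact_fixpt.
have {}lY Z : (if upper then ExpM (R:=R) (V:=V) else Exp1M (R:=R) (V:=V)) Z ->
    Phi Z = Z -> forall s, leu upper (Y s) (Z s).
  by move=> /admissibleP; apply: lY.
move: aY lY; rewrite /leu; case: upper => aY lY s.
  rewrite /lfp; case: xgetP => [X -> [DX fX lX]|/(_ Y) []]; first exact: lX.
  by split=> // Z; apply: lY.
rewrite /gfp; case: xgetP => [X -> [DX fX lX]|/(_ Y) []]; first exact: lX.
by split=> // Z; apply: lY.
Qed.

Section Loop.
Variables (phi : guard) (B : cmd V term guard) (f : exptn R V).
Hypotheses (lfB : loop_free B) (af : admissible upper f).

Definition loop_functional (Y : exptn R V) : exptn R V := fun s =>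
  iverson R (~~ guard_sem phi (ext s)) * f s
  + iverson R (guard_sem phi (ext s)) * exact_transformer (prog_den R B) Y s.

Lemma loop_functionalE Y s : loop_functional Y s =
  if guard_sem phi (ext s) then exact_transformer (prog_den R B) Y s else f s.
Proof.
by rewrite /loop_functional /iverson; case: guard_sem;
  rewrite /= mul1e mul0e ?adde0 ?add0e.
Qed.

Lemma admissible_loop_functional Y : admissible upper Y ->
  admissible upper (loop_functional Y).
Proof.
move=> aY; have [m1 p1 q1] := admissible_transformer exact_fixpt lfB aY.
case: af => mf f0 f1; split.
- have H := @measurable_neg _ _ _ _ (@measurable_guard R V phi).
  apply: emeasurable_funD; apply: emeasurable_funM => //.
    exact: (measurable_iverson H).
  exact: (measurable_iverson (@measurable_guard R V phi)).
- by move=> s; rewrite loop_functionalE; case: ifP.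
- by move=> s up; rewrite loop_functionalE; case: ifP => _;
    [apply: q1 | apply: f1].
Qed.

Lemma loop_functional_mono Y Z : admissible upper Y -> admissible upper Z ->
  (forall s, leu upper (Y s) (Z s)) ->
  forall s, leu upper (loop_functional Y s) (loop_functional Z s).
Proof.
move=> aY aZ YZ s; rewrite !loop_functionalE; case: ifP => _;
    last exact: leu_refl.
move: YZ aY aZ; rewrite /leu; case E : upper => YZ aY aZ.
  by apply: transformer_mono => //; rewrite E.
by apply: transformer_mono => //; rewrite E.
Qed.

Definition iterate (n : nat) : exptn R V :=
  iter n loop_functional (fun=> (neutral R upper)%:E).

Lemma admissible_iterate n : admissible upper (iterate n).
Proof.
elim: n => [|n IH]; first exact: admissible_neutral.
exact: admissible_loop_functional.
Qed.

Lemma neutral_least Y : admissible upper Y ->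
  forall s, leu upper (neutral R upper)%:E (Y s).
Proof.
by move=> [_ Y0 Y1] s; rewrite /leu /neutral; case: upper Y1 => // ->.
Qed.

Lemma iterate_chain n s : leu upper (iterate n s) (iterate n.+1 s).
Proof.
elim: n s => [|n IH] s; first exact: (neutral_least (admissible_iterate 1)).
exact: (loop_functional_mono (admissible_iterate n) (admissible_iterate n.+1)
    IH).
Qed.

Lemma iterate_nd : upper -> forall s, nondecreasing_seq (iterate ^~ s).
Proof.
move=> up s; apply/nondecreasing_seqP => n.
by have := iterate_chain n s; rewrite /leu up.
Qed.

Definition iterate_limit : exptn R V := fun s => limn (iterate ^~ s).

Lemma cvg_iterate s : iterate ^~ s @ \oo --> iterate_limit s.
Proof.
have [up|up] := boolP upper.
  exact/ereal_nondecreasing_is_cvgn/iterate_nd.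
apply/ereal_nonincreasing_is_cvgn/nonincreasing_seqP => n.
by have := iterate_chain n s; rewrite /leu (negPf up).
Qed.

Lemma leu_limit s y : (forall n, leu upper (iterate n s) y) ->
    leu upper (iterate_limit s) y.
Proof.
have := @cvg_iterate s; rewrite /leu; case: upper => cy h.
  by apply: cvge_to_le cy _; apply: nearW.
by apply: cvge_to_ge cy _; apply: nearW.
Qed.

Lemma admissible_limit : admissible upper iterate_limit.
Proof.
split.
- apply: emeasurable_fun_cvg => [n|s _]; last exact: cvg_iterate.
  by have [] := admissible_iterate n.
- move=> s; apply: cvge_to_ge (@cvg_iterate s) _; apply: nearW => n.
  by have [_ + _] := admissible_iterate n.
- move=> s up; apply: cvge_to_le (@cvg_iterate s) _; apply: nearW => n.
  by have [_ _ +] := admissible_iterate n; apply.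
Qed.

(** The shifted iterates converge to the limit and, by continuity of the body, to the image of the
    limit; limits are unique. *)
Lemma loop_functional_limit : loop_functional iterate_limit = iterate_limit.
Proof.
apply/funext => s.
have c1 : (fun n => iterate n.+1 s) @ \oo --> iterate_limit s.
  by have := @cvg_iterate s; rewrite -cvg_shiftS; apply.
have c2 : (fun n => iterate n.+1 s) @ \oo --> loop_functional iterate_limit s.
  have -> : (fun n => iterate n.+1 s) = fun n =>
      if guard_sem phi (ext s) then exact_transformer (prog_den R B)
          (iterate n) s
      else f s.
    by apply/funext => n; rewrite /iterate iterS loop_functionalE.
  rewrite loop_functionalE; case: guard_sem; last exact: cvg_cst.
  apply: transformer_cvg => //.
  - exact: admissible_iterate.
  - exact: admissible_limit.
  - exact: iterate_nd.
  - exact: cvg_iterate.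
exact: (cvg_unique _ c2 c1).
Qed.

Lemma exact_loop_bound Z : (forall s, 0 <= Z s) ->
  (forall s, leu upper (iverson R (guard_sem phi (ext s))
      * riemann_transformer upper N (prog_den R B) Z s
    + iverson R (~~ guard_sem phi (ext s)) * f s) (Z s)) ->
  (forall s, leu upper (neutral R upper)%:E (Z s)) ->
  forall s, leu upper (exact_transformer (While (fun s => guard_sem phi (ext s))
    (prog_den R B)) f s) (Z s).
Proof.
move=> Z0 inv nZ s; apply: (@leu_trans _ _ (iterate_limit s)).
  apply: exact_fixpt_least; [exact: admissible_limit|exact:
      loop_functional_limit|].
  (* Every iterate, and hence the limit, is bounded by any admissible fixed point [Y]. *)
  move=> Y aY fY s'; apply: leu_limit => n; elim: n s' => [|n IH] s'.
    exact: neutral_least.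
  rewrite -fY; apply: loop_functional_mono => //; exact: admissible_iterate.
(* One exact step from an iterate bounded by [Z] is bounded by one Riemann step from [Z], which the
   invariant bounds by [Z]. Thus the two transformers are compared on the loop-free body alone. *)
apply: leu_limit => n; elim: n s => [|n IH] s; first exact: nZ.
apply: leu_trans (inv s); rewrite /iterate iterS /loop_functional addeC.
apply: leu_add; last exact: leu_refl.
apply: leu_scale; first by rewrite ler0n.
by have [_] := transformer_riemann N_gt0 exact_fixpt
  (if upper then lfp (Exp (R:=R) (V:=V)) else gfp (Exp1 (R:=R) (V:=V)))
  lfB (admissible_iterate n) Z0 IH.
Qed.

End Loop.
End Loops.

(** * Assembling decidability and soundness *)

Lemma expr_den_ge0 (R : realType) (V : {fset nat}) (I : expr) :
  quantifier_free I -> forall s : state R V, (0 <= expr_den I s)%E.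
Proof. by move=> qI s; have [] := expr_sem_fin (ext s) qI. Qed.

Unset Implicit Arguments.

Theorem theorem8p14 (R : realType) (V : {fset nat}) :
  ((exists P : seq fl_expr,
      forall (phi : guard) (B : cmd V term guard) (I f : expr) (N : nat),
        pwhile (While phi B) -> loop_free B ->
        syntactic_expectation V I -> syntactic_expectation V f ->
        quantifier_free I -> quantifier_free f -> (1 <= N)%N ->
        exists F : qf_formula,
          computes P (enc_input (While phi B) I f N) (enc_formula F) /\
          (qf_valid R F <->
           superinvariant N (prog_den R (While phi B))
             (expr_den f) (expr_den I))) /\
   (forall (phi : guard) (B : cmd V term guard) (I f : expr) (N : nat),
      pwhile (While phi B) -> loop_free B ->
      syntactic_expectation V I -> syntactic_expectation V f ->
      quantifier_free I -> quantifier_free f -> (1 <= N)%N ->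
      superinvariant N (prog_den R (While phi B)) (expr_den f) (expr_den I) ->
      ExpM (expr_den f : exptn R V) ->
      ele (wp (prog_den R (While phi B)) (expr_den f)) (expr_den I))) /\
  ((exists P : seq fl_expr,
      forall (phi : guard) (B : cmd V term guard) (J g : expr) (N : nat),
        pwhile (While phi B) -> loop_free B ->
        syntactic_expectation V J -> syntactic_expectation V g ->
        Exp1 (expr_den J : exptn R V) ->
        Exp1 (expr_den g : exptn R V) ->
        quantifier_free J -> quantifier_free g -> (1 <= N)%N ->
        exists F : qf_formula,
          computes P (enc_input (While phi B) J g N) (enc_formula F) /\
          (qf_valid R F <->
           subinvariant N (prog_den R (While phi B))
             (expr_den g) (expr_den J))) /\
   (forall (phi : guard) (B : cmd V term guard) (J g : expr) (N : nat),
      pwhile (While phi B) -> loop_free B ->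
      syntactic_expectation V J -> syntactic_expectation V g ->
      Exp1 (expr_den J : exptn R V) ->
      Exp1 (expr_den g : exptn R V) ->
      quantifier_free J -> quantifier_free g -> (1 <= N)%N ->
      subinvariant N (prog_den R (While phi B)) (expr_den g) (expr_den J) ->
      Exp1M (expr_den g : exptn R V) ->
      ele (expr_den J) (wlp (prog_den R (While phi B)) (expr_den g)))).
Proof.
split; split.
- exists (program true) => phi B I f N pw lf IV fV qI qf N0.
  exists (reduction true N phi B I f); split; first exact: program_correct.
  apply: (iff_trans (reductionP N0 pw lf IV fV qI qf _)); first by [].
  by split=> [h|[]] //; split=> // s; apply: expr_den_ge0.
- move=> phi B I f N pw lf IV fV qI qf N0 [I0 inv] mf s.
  apply: (exact_loop_bound (upper := true) N0 lf) => //.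
  exact/(admissibleP true).
- exists (program false) => phi B J g N pw lf JV gV J1 g1 qJ qg N0.
  exists (reduction false N phi B J g); split; first exact: program_correct.
  apply: (iff_trans (reductionP N0 pw lf JV gV qJ qg _)).
    (* The bound by 1 is what makes 1 a harmless value for choices outside their piece. *)
    by move=> s; have /andP[] := J1 s.
  by split=> [h|[]].
- move=> phi B J g N pw lf JV gV J1 g1 qJ qg N0 [_ inv] mg s.
  apply: (exact_loop_bound (upper := false) N0 lf) => //.
  + exact/(admissibleP false).
  + by move=> s'; have /andP[] := J1 s'.
  + by move=> s'; have /andP[] := J1 s'.
Qed.
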